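(* Let $\gamma_->2$ and $p_+\in(0,1)$ be constants and let $(p,\gamma,k)\in\Lambda_{\gamma_-,p_+}$. Then, with probability tending to $1$ as $n\to\infty$, the random graph $G(n,p)$ contains at least \[\min\left\{\frac{\min\{\gamma-2,1\}\,p n^2\log n}{40k^4},\ \frac{pn^2}{2k^2}\right\}\] pairwise edge-disjoint $k$-cliques.
   Context: $G(n,p)$ is the Erdős–Rényi random graph on vertex set $\{1,\dots,n\}$. For $p,n,k$ let $E_p(n,k)=\binom{n}{k}p^{\binom{k}{2}}$ and $\gamma(p,n,k)=\log E_p(n,k)/\log n$. For $\gamma_->2$ and $p_+\in(0,1)$, $\Lambda_{\gamma_-,p_+}$ is the family of triples of sequences $(p,\gamma,k)=(p_n,\gamma_n,k_n)_{n\ge1}$ such that: (i) $p_n\in(0,p_+)$ for all $n$ and $\log p_n/\log n\to 0$; (ii) $k_n\ge \log_{1/p_n} n$; (iii) $\gamma_n=\gamma(p_n,n,k_n)$ and $\gamma_n\ge\gamma_-$ for all $n$. $\log$ is the natural logarithm. *)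

(* Defs.v *)
From HB Require Import structures.
From mathcomp Require Import all_boot all_order all_algebra.
From mathcomp Require Import all_classical all_reals all_analysis.

Set Implicit Arguments.
Unset Strict Implicit.
Unset Printing Implicit Defensive.

Import Order.TTheory GRing.Theory Num.Theory.
Import numFieldNormedType.Exports.

Local Open Scope classical_set_scope.
Local Open Scope ring_scope.

(* Vertices are 'I_n; a simple graph on 'I_n is identified with its edge set,
   a subset of pairs_of [set: 'I_n]. *)
Definition pairs_of (n : nat) (K : {set 'I_n}) : {set {set 'I_n}} :=
  [set e : {set 'I_n} | (e \subset K) && (#|e| == 2%N)]%SET.

Definition is_graph (n : nat) (G : {set {set 'I_n}}) : bool :=
  G \subset pairs_of [set: 'I_n]%SET.

(* The law of G(n, p): every potential edge is present independently with
   probability p. *)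
Definition Gnp_weight (R : realType) (n : nat) (p : R) (G : {set {set 'I_n}}) : R :=
  \prod_(e in pairs_of [set: 'I_n]%SET) (if e \in G then p else 1 - p).

Definition Gnp_prob (R : realType) (n : nat) (p : R)
    (A : pred {set {set 'I_n}}) : R :=
  \sum_(G : {set {set 'I_n}} | is_graph G && A G) Gnp_weight p G.

Definition is_kclique (n k : nat) (G : {set {set 'I_n}}) (K : {set 'I_n}) : bool :=
  (#|K| == k) && (pairs_of K \subset G).

Definition edge_disjoint_kcliques (n k : nat) (G : {set {set 'I_n}})
    (F : {set {set 'I_n}}) : bool :=
  [forall K in F, is_kclique k G K] &&
  [forall K1 in F, forall K2 in F,
     (K1 != K2) ==> [disjoint pairs_of K1 & pairs_of K2]].

Definition has_edge_disjoint_kcliques (R : realType) (n k : nat) (m : R)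
    (G : {set {set 'I_n}}) : bool :=
  [exists F : {set {set 'I_n}},
     edge_disjoint_kcliques k G F && (m <= #|F|%:R)].

Definition expected_kcliques (R : realType) (p : R) (n k : nat) : R :=
  'C(n, k)%:R * p ^+ 'C(k, 2).

Definition gamma_of (R : realType) (p : R) (n k : nat) : R :=
  ln (expected_kcliques p n k) / ln n%:R.

(* The family Lambda_{gamma_-, p_+}.  The formula for gamma_n is imposed for
   n >= 2 only, as log 1 = 0.  The bound gamma_n >= gamma_- is imposed for all
   large n: since gamma_- > 2 it forces 'C(n, k_n) > n ^ 2, which is impossible
   for 2 <= n <= 7, so requiring it for every n would make the family empty. *)
Definition Lambda (R : realType) (gamma_minus p_plus : R)
    (p gamma : nat -> R) (k : nat -> nat) : Prop :=
  [/\ (forall n : nat, (1 <= n)%N -> 0 < p n < p_plus),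
      (fun n : nat => ln (p n) / ln n%:R) @ \oo --> (0 : R),
      (forall n : nat, (1 <= n)%N -> ln n%:R / ln (p n)^-1 <= (k n)%:R),
      (forall n : nat, (2 <= n)%N -> gamma n = gamma_of (p n) n (k n)) &
      (\forall n \near \oo, gamma_minus <= gamma n)].

Definition clique_bound (R : realType) (p gamma : R) (n k : nat) : R :=
  Num.min
    (Num.min (gamma - 2) 1 * p * n%:R ^+ 2 * ln n%:R / (40 * k%:R ^+ 4))
    (p * n%:R ^+ 2 / (2 * k%:R ^+ 2)).

(* Main.v *)
(* The [k]-cliques of a graph [G] form an [r]-uniform hypergraph on the edges of
   [G], with [r = 'C(k, 2)], and the theorem asks for a large matching in it.

   A second moment computation shows that, up to deleting few cliques, every edge
   of [G(n, p)] lies in about [D0 = r * mu / (p * 'C(n, 2))] cliques, [mu] being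
   the mean number of cliques, and any two edges lie together in at most
   [D0 / g ^+ 5] of them, where [g] is a small power of [n].

   The matching is built by a derandomized greedy process.  At each step the
   process takes an alive clique, or deletes a single edge, with weights chosen
   so that every alive edge disappears with the same probability [1 / N].  Hence
   all degrees decay at the same rate [(r - 1) / N] per step.  The potential
   "cliques taken + expected future gain - penalty", whose penalty sums
   exponentials of the degrees, never decreases on average, so some run keeps all
   degrees below their trajectory and takes as many cliques as expected.  The
   process survives until degrees have dropped by a power of [n], that is, for
   about [N * log n / r] steps: this is where the factor [log n] comes from. *)

Require Import Defs.
From HB Require Import structures.
From mathcomp Require Import all_boot all_order all_algebra.
From mathcomp Require Import all_classical all_reals all_analysis.
From mathcomp Require Import ring lra.
From mathcomp Require Import fintype finset.

Set Implicit Arguments.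
Unset Strict Implicit.
Unset Printing Implicit Defensive.

Import Order.TTheory GRing.Theory Num.Theory.
Import numFieldNormedType.Exports.

Local Open Scope ring_scope.

(** * Matchings in nearly regular hypergraphs *)

(** All exponents and constants come from one budget. About [sig * N] steps multiply degrees by
    roughly [expR (- sig * r)], and this factor is only guaranteed to stay above [1 / g ^ 2]. The
    penalty beats the polynomial factors once [lam * kap * D0 >= g ^ 2], so [lam] is of order
    [g ^ 3 / D0] up to powers of [r]. It also needs [lam] times the one-step loss [r * C] to stay
    below [kap] at the last step, where [lam] has grown by up to [g ^ 2]. Hence [C = D0 / g ^ 5].
    Overlaps are kept below their trivial size by [n ^ 2 * g ^ 7]: one [g] pays for Markov, five for
    division by [C], and the last absorbs powers of [k] and [r].

    Pairs of nearly equal cliques are where [gamma > 2] enters: their terms are at most 1 and must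
    lie below [mu / (n ^ 2 * g ^ 7)]. With [a = min (gamma - 2) 1] the choice [g = n ^ (a / 40)]
    fits. Then [expR (2 * sig * r) <= g ^ 2] and [r <= k ^ 2 / 2] lead to
    [sig = a * ln n / (20 * k ^ 2)]; the guaranteed [sig * W / (2 * r)] edge-disjoint cliques, [W]
    being the mean number of edges, give the first term of the bound, and capping [sig] at 1 gives
    the second. *)

Lemma exists_ge_average (R : realType) (J : finType) (w x : J -> R) (v : R) :
  (forall j, 0 <= w j) -> \sum_j w j = 1 -> v <= \sum_j w j * x j ->
  exists j, 0 < w j /\ v <= x j.
Proof.
move=> w0 w1 vx.
apply: contrapT => no.
have H j : w j * x j <= w j * v.
  have := w0 j; rewrite le_eqVlt => /orP[/eqP <-|wj]; first by rewrite !mul0r.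
  rewrite ler_pM2l // leNgt; apply/negP => h; apply: no.
  by exists j; split => //; exact: ltW.
have [j wj] : exists j, 0 < w j.
  apply: contrapT => nw.
  suff : \sum_j w j = 0 by rewrite w1 => /eqP; rewrite oner_eq0.
  rewrite big1 // => j _; apply/eqP; rewrite eq_le w0 andbT leNgt.
  by apply/negP => h; apply: nw; exists j.
have Hj : w j * x j < w j * v.
  by rewrite ltr_pM2l // ltNge; apply/negP => h; apply: no; exists j.
have : \sum_i w i * x i < \sum_i w i * v.
  rewrite (bigD1 j) //= [ltRHS](bigD1 j) //=.
  by apply: ltr_leD => //; apply: ler_sum => i _.
by rewrite -mulr_suml w1 mul1r ltNge vx.
Qed.

Lemma expRN_le (R : realType) (z : R) : 0 <= z -> expR (- z) <= 1 - z + z ^+ 2.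
Proof.
move=> z0; rewrite expRN.
have h := expR_ge1Dx z.
have h1 : 0 < 1 + z by lra.
apply: (@le_trans _ _ (1 + z)^-1); first by rewrite lef_pV2 // posrE ?expR_gt0.
rewrite -[leLHS]div1r ler_pdivrMr //.
have -> : (1 - z + z ^+ 2) * (1 + z) = 1 + z ^+ 3 by ring.
by rewrite lerDl exprn_ge0.
Qed.

Section Nibble.
Variables (R : realType) (T I : finType) (s : I -> {set T}) (V : {set T})
  (H : {set I}) (r : nat) (C : R).
Hypothesis sr : forall K, K \in H -> #|s K| = r.

Definition alive (U : {set T}) : {set I} := [set K in H | s K \subset U].

Definition degree (U : {set T}) (e : T) : nat :=
  #|[set K in alive U | e \in s K]|.

Definition codegree (e f : T) : nat :=
  #|[set K in H | (e \in s K) && (f \in s K)]|.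

Hypothesis C0 : 0 <= C.
Hypothesis codegC : forall e f, e != f -> (codegree e f)%:R <= C.

Lemma degree_sum (U : {set T}) (e : T) :
  (degree U e)%:R = \sum_(K in alive U) (e \in s K)%:R :> R.
Proof.
rewrite /degree -sum1_card natr_sum (eq_bigl (fun K => (K \in alive U) && (e \in s K))).
  by rewrite big_mkcondr; apply: eq_bigr => K _; case: (e \in s K).
by move=> K; rewrite inE.
Qed.

Lemma codegree_sum (e f : T) :
  (codegree e f)%:R = \sum_(K in H) ((e \in s K) && (f \in s K))%:R :> R.
Proof.
rewrite /codegree -sum1_card natr_sum
  (eq_bigl (fun K => (K \in H) && ((e \in s K) && (f \in s K)))).
  by rewrite big_mkcondr; apply: eq_bigr => K _; case: (_ && _).
by move=> K; rewrite inE.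
Qed.

Lemma sum_degree (U : {set T}) :
  \sum_(e in U) (degree U e)%:R = r%:R * #|alive U|%:R :> R.
Proof.
under eq_bigr do rewrite degree_sum.
rewrite exchange_big /= mulr_natr -sumr_const.
apply: eq_bigr => K; rewrite inE => /andP[KH KU].
rewrite -(sr KH) -sum1_card natr_sum big_mkcond [RHS]big_mkcond.
apply: eq_bigr => e _; case: ifP => eU; case: ifP => eK //=.
by rewrite (subsetP KU) in eU.
Qed.

Lemma aliveD (U S : {set T}) :
  alive (U :\: S) = [set K in alive U | [disjoint s K & S]].
Proof. by apply/setP => K; rewrite !inE subsetD andbA. Qed.

(** * One random deletion step *)

Section Step.
Variables (U : {set T}) (b tau : R).
Hypothesis degb : forall e, e \in U -> (degree U e)%:R <= b.
Hypothesis tau0 : 0 <= tau.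
Hypothesis taub : tau * b * #|U|%:R <= 1.
Hypothesis r_gt0 : (0 < r)%N.

(* The random step: an alive hyperedge, a single vertex, or nothing is
   deleted; the weights of the singletons compensate irregular degrees, so that
   every alive vertex is deleted with the same probability [tau * b]. *)
Definition kill (j : option (I + T)) : {set T} :=
  match j with Some (inl K) => s K | Some (inr e) => [set e] | None => set0 end.

Definition gain (j : option (I + T)) : R :=
  match j with Some (inl _) => 1 | _ => 0 end.

Definition idle : R :=
  1 - tau * (#|alive U|%:R + \sum_(e in U) (b - (degree U e)%:R)).

Definition wt (j : option (I + T)) : R :=
  match j with
  | Some (inl K) => if K \in alive U then tau else 0
  | Some (inr e) => if e \in U then tau * (b - (degree U e)%:R) else 0
  | None => idle
  end.

Lemma sum_step (g : option (I + T) -> R) :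
  \sum_j wt j * g j =
    \sum_(K in alive U) tau * g (Some (inl K)) +
    \sum_(e in U) tau * (b - (degree U e)%:R) * g (Some (inr e)) + idle * g None.
Proof.
rewrite (bigD1 None) //= addrC (reindex_omap Some id) /=; last by case.
under eq_bigl do rewrite eqxx.
rewrite big_sumType /=; congr (_ + _ + _).
- by rewrite [RHS]big_mkcond; apply: eq_bigr => K _; case: ifP; rewrite ?mul0r.
- by rewrite [RHS]big_mkcond; apply: eq_bigr => K _; case: ifP; rewrite ?mul0r.
Qed.

(** The degrees over [U] sum to [r * #|alive U|], which is at least the number of alive hyperedges;
    so the other weights add up to at most [tau * b * #|U|]. *)
Lemma idle_ge0 : 0 <= idle.
Proof.
rewrite subr_ge0; apply: le_trans taub; rewrite -mulrA ler_wpM2l //.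
rewrite sumrB sum_degree sumr_const -mulr_natr.
have : #|alive U|%:R <= r%:R * #|alive U|%:R :> R by rewrite ler_peMl // ler1n.
by lra.
Qed.

Lemma wt_ge0 j : 0 <= wt j.
Proof.
case: j => [[K|e]|] /=; last exact: idle_ge0.
- by case: ifP.
- by case: ifP => // eU; rewrite mulr_ge0 // subr_ge0 degb.
Qed.

Lemma wt_sum : \sum_j wt j = 1.
Proof.
transitivity (\sum_j wt j * 1); first by apply: eq_bigr => j _; rewrite mulr1.
rewrite sum_step mulr1 sumr_const mulr1 /idle.
under eq_bigr do rewrite mulr1.
by rewrite -mulr_sumr -mulr_natr; ring.
Qed.

Lemma wt_gain : \sum_j wt j * gain j = tau * #|alive U|%:R.
Proof.
rewrite sum_step /= mulr0 addr0 [X in _ + X]big1 ?addr0; last by move=> *; rewrite mulr0.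
by rewrite mulr1 sumr_const mulr_natr.
Qed.

Lemma wt_kill f : f \in U -> \sum_j wt j * (f \in kill j)%:R = tau * b.
Proof.
move=> fU; rewrite sum_step /= inE mulr0 addr0 -mulr_sumr -degree_sum.
rewrite (bigD1 f) //= inE eqxx mulr1 [X in _ + (_ + X)]big1 ?addr0; first by ring.
by move=> e /andP[_ ef]; rewrite inE eq_sym (negbTE ef) mulr0.
Qed.

(** Deleting a singleton cannot remove two distinct vertices, so only the hyperedges through both of
    them count. *)
Lemma wt_kill2 f g : f != g ->
  \sum_j wt j * ((f \in kill j) && (g \in kill j))%:R <= tau * C.
Proof.
move=> fg; rewrite sum_step /= inE mulr0 addr0 -mulr_sumr.
rewrite [X in _ + X]big1 ?addr0 => [|e _]; last first.
  rewrite !inE; case: eqP => [<-|_] /=; last by rewrite mulr0.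
  by rewrite eq_sym (negbTE fg) mulr0.
rewrite ler_wpM2l //; apply: le_trans (codegC fg).
rewrite codegree_sum [leRHS](bigID (mem (alive U))) /= -[leLHS]addr0.
apply: lerD; last by apply: sumr_ge0.
rewrite le_eqVlt; apply/orP; left; apply/eqP; apply: eq_bigl => K.
by rewrite !inE; case: (K \in H).
Qed.

Definition loss (e : T) (S : {set T}) : nat :=
  #|[set K in alive U | (e \in s K) && ~~ [disjoint s K & S]]|.

Lemma loss_sum e S :
  (loss e S)%:R =
  \sum_(K in alive U | e \in s K) (~~ [disjoint s K & S])%:R :> R.
Proof.
rewrite /loss -sum1_card natr_sum
 (eq_bigl (fun K => ((K \in alive U) && (e \in s K)) && ~~ [disjoint s K & S])).
  by rewrite big_mkcondr; apply: eq_bigr => K _; case: [disjoint _ & _].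
by move=> K; rewrite inE andbA.
Qed.

Lemma degreeD e S : (degree (U :\: S) e)%:R = (degree U e)%:R - (loss e S)%:R :> R.
Proof.
apply/eqP; rewrite eq_sym subr_eq -natrD eqr_nat; apply/eqP.
rewrite /degree /loss -(cardsID [set K | [disjoint s K & S]] [set K in alive U | e \in s K]).
by congr (_ + _)%N; apply: eq_card => K; rewrite ?aliveD !inE;
  case: [disjoint _ & _]; rewrite ?andbT ?andbF.
Qed.

(** A lost hyperedge through [e] also contains a deleted [f], distinct from [e] because [e]
    survives. Sum the codegrees over the at most [r] deleted vertices. *)
Lemma loss_kill e j : 0 < wt j -> e \notin kill j ->
  (loss e (kill j))%:R <= r%:R * C.
Proof.
move=> wj ej.
have cj : (#|kill j| <= r)%N.
  case: j wj ej => [[K|f]|] /=; rewrite ?cards1 ?cards0 //.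
  by case: ifP; rewrite ?ltxx // inE => /andP[KH _] _ _; rewrite (sr KH).
apply: (@le_trans _ _ (\sum_(f in kill j) (codegree e f)%:R)).
  rewrite loss_sum.
  under [leRHS]eq_bigr do rewrite codegree_sum.
  rewrite exchange_big /= [leRHS](bigID (fun K => (K \in alive U) && (e \in s K))) /=.
  rewrite -[leLHS]addr0; apply: lerD; last by do 2!apply: sumr_ge0 => ? _.
  rewrite [leRHS](eq_bigl (fun K => (K \in alive U) && (e \in s K))); last first.
    by move=> K; rewrite inE; case: (K \in H).
  apply: ler_sum => K /andP[_ eK]; rewrite eK /=.
  case: (boolP [disjoint _ & _]) => dj /=; first by apply: sumr_ge0.
  move: dj; rewrite -setI_eq0 => /set0Pn[f]; rewrite inE => /andP[fK fj].
  by rewrite (bigD1 f) //= fK lerDl sumr_ge0.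
apply: (@le_trans _ _ (\sum_(f in kill j) C)).
  by apply: ler_sum => f fj; apply: codegC; apply: contraNneq ej => ->.
by rewrite sumr_const -[leLHS]mulr_natl ler_wpM2r // ler_nat.
Qed.

(** Union bound: an alive hyperedge has [r] vertices, each deleted with probability [tau * b]. *)
Lemma alive_kill_ge : 0 <= tau * b ->
  (1 - r%:R * (tau * b)) * #|alive U|%:R <=
  \sum_j wt j * #|alive (U :\: kill j)|%:R.
Proof.
move=> tb.
apply: (@le_trans _ _ (\sum_j wt j *
   (\sum_(K in alive U) (1 - \sum_(f in s K) (f \in kill j)%:R)))); last first.
  apply: ler_sum => j _; rewrite ler_wpM2l ?wt_ge0 //.
  rewrite aliveD -sum1_card natr_sum [leRHS](eq_bigl (fun K =>
     (K \in alive U) && [disjoint s K & kill j])); last by move=> K; rewrite inE.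
  rewrite [leRHS]big_mkcondr; apply: ler_sum => K _; case: ifPn => dj.
    by rewrite gerBl sumr_ge0.
  move: dj; rewrite -setI_eq0 => /set0Pn[f]; rewrite inE => /andP[fK fj].
  by rewrite subr_le0 (bigD1 f) //= fj lerDl sumr_ge0.
under eq_bigr do rewrite mulr_sumr.
rewrite exchange_big /= mulr_natr -sumr_const.
apply: ler_sum => K; rewrite inE => /andP[KH KU].
under eq_bigr do rewrite mulrBr mulr1 mulr_sumr.
rewrite sumrB wt_sum exchange_big /=.
rewrite (eq_bigr (fun=> tau * b)); last first.
  by move=> f fK; rewrite wt_kill // (subsetP KU).
by rewrite sumr_const (sr KH) mulr_natl.
Qed.

(* Bonferroni: with [x] the number of vertices of [s K :\ e] that are deleted,
   [x - x (x - 1)] is at most the indicator of [0 < x]. *)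
Lemma loss_ge e : e \in U ->
  (degree U e)%:R * ((r%:R - 1) * (tau * b) - r%:R ^+ 2 * (tau * C)) <=
  \sum_j wt j * ((e \notin kill j)%:R * (loss e (kill j))%:R).
Proof.
move=> eU.
(* The inner sum runs over [s K :\ f] and so includes [e]. If [e] itself is deleted, the pair
   [(f, e)] cancels the contribution of each deleted [f] and [A] is nonpositive, as the factor
   [e \notin kill j] requires. *)
pose A K (S : {set T}) : R := \sum_(f in s K :\ e) (f \in S)%:R -
  \sum_(f in s K :\ e) \sum_(g in s K :\ f) ((f \in S) && (g \in S))%:R.
apply: (@le_trans _ _ (\sum_j wt j * \sum_(K in alive U | e \in s K) A K (kill j)));
    last first.
  apply: ler_sum => j _; rewrite ler_wpM2l ?wt_ge0 //.
  rewrite loss_sum mulr_sumr; apply: ler_sum => K /andP[_ eK].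
  move: (kill j) => S; rewrite /A -sumrB.
  case: (boolP (e \in S)) => eS /=.
    rewrite mul0r; apply: sumr_le0 => f; rewrite 2!inE => /andP[fe fK].
    case: (f \in S) => /=; last by rewrite sub0r oppr_le0 sumr_ge0.
    rewrite subr_le0 (bigD1 e) ?eS /= ?lerDl ?sumr_ge0 //.
    by rewrite !inE eq_sym fe.
  rewrite mul1r; case: (boolP [disjoint s K & S]) => dj /=.
    apply: sumr_le0 => f; rewrite 2!inE => /andP[fe fK].
    by rewrite (disjointFr dj fK) /= sub0r oppr_le0 sumr_ge0.
  move: dj; rewrite -setI_eq0 => /set0Pn[f0]; rewrite inE => /andP[fK fj].
  have f0e : f0 != e by apply: contraNneq eS => <-.
  rewrite (bigD1 f0) /= ?in_setD1 ?f0e // fj /= -[leRHS]addr0.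
  apply: lerD; first by rewrite gerBl sumr_ge0.
  apply: sumr_le0 => f; rewrite in_setD1 => /andP[/andP[fe fK'] ff0].
  case: (f \in S) => /=; last by rewrite sub0r oppr_le0 sumr_ge0.
  rewrite subr_le0 (bigD1 f0) ?fj /= ?lerDl ?sumr_ge0 //.
  by rewrite in_setD1 eq_sym ff0.
under [leRHS]eq_bigr do rewrite mulr_sumr.
rewrite exchange_big /= degree_sum mulr_suml [leRHS]big_mkcondr.
apply: ler_sum => K; rewrite inE => /andP[KH KU].
case: ifP => eK; last by rewrite mul0r.
rewrite mul1r /A.
under eq_bigr do rewrite mulrBr !mulr_sumr.
rewrite sumrB; apply: lerB.
  rewrite exchange_big /= (eq_bigr (fun=> tau * b)); last first.
    by move=> f; rewrite in_setD1 => /andP[_ fK]; rewrite wt_kill // (subsetP KU).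
  rewrite sumr_const -[leRHS]mulr_natl; suff -> : #|s K :\ e|%:R = r%:R - 1 :> R by [].
  by rewrite -(sr KH) (cardsD1 e (s K)) eK natrD addrAC subrr add0r.
rewrite exchange_big /=.
apply: (@le_trans _ _ (\sum_(f in s K :\ e) \sum_(g in s K :\ f) tau * C)).
  apply: ler_sum => f _; under eq_bigr do rewrite mulr_sumr.
  rewrite exchange_big /=; apply: ler_sum => g; rewrite in_setD1 => /andP[gf _].
  by apply: wt_kill2; rewrite eq_sym.
have sub f : (#|s K :\ f| <= r)%N by rewrite -(sr KH) subset_leq_card ?subD1set.
apply: (@le_trans _ _ (\sum_(f in s K :\ e) r%:R * (tau * C))).
  apply: ler_sum => f _; rewrite sumr_const -[leLHS]mulr_natl ler_wpM2r ?mulr_ge0 //.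
  by rewrite ler_nat sub.
rewrite sumr_const -[leLHS]mulr_natl expr2 -[leRHS]mulrA ler_wpM2r ?mulr_ge0 //.
by rewrite ler_nat sub.
Qed.

(** With [z = lam * loss <= kap], the bound [1 - z + z ^ 2 <= 1 - (1 - kap) * z] linearizes the
    exponential of the new degree, so that [loss_ge] applies to its mean. The result is again an
    exponential, with a smaller parameter, and this allows iteration. *)
Lemma exp_degree_le e (lam kap rho : R) : e \in U -> 0 <= lam -> kap <= 1 ->
  lam * (r%:R * C) <= kap ->
  rho <= (1 - kap) * ((r%:R - 1) * (tau * b) - r%:R ^+ 2 * (tau * C)) ->
  \sum_j wt j * ((e \notin kill j)%:R * expR (lam * (degree (U :\: kill j) e)%:R)) <=
  expR (lam * (1 - rho) * (degree U e)%:R).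
Proof.
move=> eU lam0 kap1 lamC rhole.
set d := (degree U e)%:R.
apply: (@le_trans _ _ (\sum_j wt j * (expR (lam * d) *
   (1 - lam * (1 - kap) * ((e \notin kill j)%:R * (loss e (kill j))%:R))))).
  apply: ler_sum => j _.
  have := wt_ge0 j; rewrite le_eqVlt => /orP[/eqP <-|wj]; first by rewrite !mul0r.
  rewrite ler_pM2l //; case: (boolP (e \in kill j)) => ej /=.
    by rewrite !mul0r mulr0 subr0 mulr1 expR_ge0.
  rewrite !mul1r degreeD mulrBr -/d expRD ler_pM2l ?expR_gt0 //.
  set c := (loss _ _)%:R.
  have c0 : 0 <= c by [].
  have cC : lam * c <= kap.
    by apply: le_trans lamC; rewrite ler_wpM2l // /c loss_kill.
  apply: le_trans (expRN_le _) _; first by rewrite mulr_ge0.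
  have : (lam * c) * (lam * c) <= kap * (lam * c) by rewrite ler_wpM2r // mulr_ge0.
  by rewrite expr2; lra.
apply: (@le_trans _ _ (expR (lam * d) * (1 - lam * (1 - kap) *
   \sum_j wt j * ((e \notin kill j)%:R * (loss e (kill j))%:R)))).
  rewrite le_eqVlt; apply/orP; left; apply/eqP.
  rewrite -[X in _ = _ * (X - _)]wt_sum [in RHS]mulr_sumr -sumrB mulr_sumr.
  by apply: eq_bigr => j _; ring.
apply: (@le_trans _ _ (expR (lam * d) * (1 - lam * rho * d))).
  rewrite ler_pM2l ?expR_gt0 // lerD2l lerN2 -!mulrA ler_wpM2l //.
  have k1 : 0 <= 1 - kap by rewrite subr_ge0.
  apply: le_trans (_ : (1 - kap) * (d *
      ((r%:R - 1) * (tau * b) - r%:R ^+ 2 * (tau * C))) <= _).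
    by rewrite [leRHS]mulrCA mulrC ler_wpM2l.
  by rewrite ler_wpM2l // loss_ge.
have -> : lam * (1 - rho) * d = lam * d - lam * rho * d by ring.
by rewrite expRD ler_pM2l ?expR_gt0 // expR_ge1Dx.
Qed.

End Step.

(** * Iterating the step under a potential *)

Section Run.
Variables (D B lam kap rho : R) (t : nat).
Hypothesis r_gt0 : (0 < r)%N.
Hypothesis rV : (r <= #|V|)%N.
Hypothesis sV : forall K, K \in H -> s K \subset V.
Hypothesis degD : forall e, e \in V -> (degree V e)%:R <= D.
Hypothesis B0 : 0 < B.
Hypothesis rho01 : 0 <= rho < 1.
Hypothesis lam0 : 0 <= lam.
Hypothesis kap1 : kap <= 1.

Let N : R := #|V|%:R.
Let th := 1 - rho.

(** [lamC] and [rhoN] are the requirements of [exp_degree_le], stated at time [t], which is the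
    worst case since [th <= 1]. [lamBD] says that the initial penalty is at most 1. *)
Hypothesis lamC : lam / th ^+ t * (r%:R * C) <= kap.
Hypothesis rhoN :
  rho * N <= (1 - kap) * (r%:R - 1 - r%:R ^+ 2 * C / (B * th ^+ t)).
Hypothesis lamBD :
  (N + t%:R * #|H|%:R / (N * B * th ^+ t)) * N * expR (lam * D) <= expR (lam * B).

Let N0 : 0 < N.
Proof. by rewrite ltr0n (leq_trans r_gt0). Qed.

Let th0 : 0 < th.
Proof. by rewrite subr_gt0; case/andP: rho01. Qed.

Let th1 : th <= 1.
Proof. by rewrite gerBl; case/andP: rho01. Qed.

(** Estimated gain per hyperedge alive at time [i]: it survives each step with probability at least
    [1 - r / N], and at time [i + j] it is taken with probability [1 / (N * B * th ^ (i + j))]. *)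
Definition future (i : nat) : R :=
  \sum_(j < t - i) (1 - r%:R / N) ^+ j / (N * B * th ^+ (i + j)).

Let q0 : 0 <= 1 - r%:R / N.
Proof. by rewrite subr_ge0 ler_pdivrMr // mul1r ler_nat. Qed.

Let pow0 i : 0 < N * B * th ^+ i.
Proof. by rewrite !mulr_gt0 // exprn_gt0. Qed.

Lemma futureS i : (i < t)%N ->
  future i = (N * B * th ^+ i)^-1 + (1 - r%:R / N) * future i.+1.
Proof.
move=> it; rewrite /future (_ : (t - i = (t - i.+1).+1)%N); last by rewrite -subSn.
rewrite big_ord_recl /= expr0 div1r addn0 mulr_sumr; congr (_ + _).
by apply: eq_bigr => j _; rewrite /bump /= add1n exprS addnS addSn -mulrA.
Qed.

Lemma future_ge0 i : 0 <= future i.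
Proof.
by apply: sumr_ge0 => j _; rewrite divr_ge0 ?exprn_ge0 // ltW.
Qed.

Lemma future_le i : future i <= t%:R / (N * B * th ^+ t).
Proof.
apply: (@le_trans _ _ (\sum_(j < t - i) (N * B * th ^+ t)^-1)).
  apply: ler_sum => j _; rewrite -[leRHS]mul1r; apply: ler_pM.
  - by rewrite exprn_ge0.
  - by rewrite invr_ge0 ltW.
  - by rewrite exprn_ile1 // gerBl divr_ge0 // ltW.
  rewrite lef_pV2 ?posrE // ler_pM2l ?mulr_gt0 //.
  rewrite ler_wiXn2l // ?ltW //.
  case: j => j /= jt; rewrite addnC -(subnK (_ : i <= t)%N) ?leq_add2r ?(ltnW jt) //.
  by rewrite ltnW // -subn_gt0 (leq_ltn_trans _ jt).
rewrite sumr_const card_ord -[leLHS]mulr_natl ler_pM2r ?invr_gt0 //.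
by rewrite ler_nat leq_subr.
Qed.

(** Normalized so that one degree above its ceiling [B * th ^ i] costs at least
    [N + t * #|H| / (N * B * th ^ t)], more than the hyperedges taken and all future gain can be
    worth. *)
Let Gam := (N + t%:R * #|H|%:R / (N * B * th ^+ t)) * expR (- (lam * B)).

Let Gam0 : 0 < Gam.
Proof. by rewrite mulr_gt0 ?expR_gt0 // ltr_wpDr // divr_ge0 // ltW. Qed.

Definition packing (F : {set I}) :=
  forall K1 K2, K1 \in F -> K2 \in F -> K1 != K2 -> [disjoint s K1 & s K2].

(** The right-hand side of the last clause is the potential; the [- 1] on the left pays for the
    penalty at time 0. The clause [#|F| + #|U| <= #|V|] keeps [#|F| + 1 <= N] as long as a vertex is
    alive. *)
Lemma nibble_invariant i : (i <= t)%N -> 0 <= future 0 * #|H|%:R - 1 ->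
  exists (F : {set I}) (U : {set T}),
  [/\ F \subset H /\ packing F, U \subset V,
      (forall K, K \in F -> [disjoint s K & U]), (#|F| + #|U| <= #|V|)%N &
      future 0 * #|H|%:R - 1 <= #|F|%:R + future i * #|alive U|%:R -
        Gam * \sum_(e in U) expR (lam / th ^+ i * (degree U e)%:R)].
Proof.
move=> + Psi0; elim: i => [_|i IH it].
  exists set0, V; split; rewrite ?sub0set ?cards0 //.
  - by split => // K1 K2; rewrite inE.
  - by move=> K; rewrite inE.
  have -> : alive V = H.
    by apply/setP => K; rewrite inE; case: (boolP (K \in H)) => // /sV ->.
  rewrite add0r lerD2l lerN2 expr0 divr1.
  apply: (@le_trans _ _ (Gam * (N * expR (lam * D)))).
    rewrite ler_pM2l // mulr_natl -sumr_const; apply: ler_sum => e eV.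
    by rewrite ler_expR ler_wpM2l // degD.
  by rewrite /Gam expRN mulrAC ler_pdivrMr ?expR_gt0 // mul1r mulrA.
have [F [U [[FH packF] UV FU FUV Psi]]] := IH (ltnW it).
pose b := B * th ^+ i.
have b0 : 0 < b by rewrite mulr_gt0 // exprn_gt0.
have UN : #|U|%:R <= N by rewrite ler_nat (leq_trans _ FUV) // leq_addl.
(* [lam / th ^ i * b] equals [lam * B] at every time. One degree above [b] would therefore push the
   potential down to at most [- 1], against the invariant and [Psi0]. *)
have degb e : e \in U -> (degree U e)%:R <= b.
  move=> eU; rewrite leNgt; apply/negP => bd.
  have : Gam * expR (lam * B) <=
      Gam * \sum_(e in U) expR (lam / th ^+ i * (degree U e)%:R).
    rewrite ler_pM2l // (bigD1 e) //= -[leLHS]addr0; apply: lerD.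
      rewrite ler_expR -[lam * B](_ : lam / th ^+ i * b = _); last first.
        by rewrite /b; field; rewrite expf_neq0 // gt_eqF.
      by rewrite ler_wpM2l ?(ltW bd) // divr_ge0 // exprn_ge0 // ltW.
    by apply: sumr_ge0 => f _; rewrite expR_ge0.
  have -> : Gam * expR (lam * B) = N + t%:R * #|H|%:R / (N * B * th ^+ t).
    by rewrite /Gam -mulrA -expRD addNr expR0 mulr1.
  have FN : #|F|%:R + 1 <= N.
    rewrite natr1 ler_nat (leq_trans _ FUV) //.
    by rewrite -addn1 leq_add2l card_gt0; apply/set0Pn; exists e.
  have : future i * #|alive U|%:R <= t%:R * #|H|%:R / (N * B * th ^+ t).
    rewrite mulrAC; apply: ler_pM; rewrite ?future_ge0 ?future_le //.
    by rewrite ler_nat subset_leq_card //; apply/subsetP => K; rewrite inE => /andP[].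
  by lra.
pose tau := (N * b)^-1.
have Nb0 : 0 < N * b by rewrite mulr_gt0.
have tau0 : 0 <= tau by rewrite invr_ge0 ltW.
have taubN : tau * b = N^-1 by rewrite /tau; field; rewrite !gt_eqF.
have taub : tau * b * #|U|%:R <= 1 by rewrite taubN mulrC ler_pdivrMr // mul1r.
(* Enlarging the parameter by [1 / (1 - rho)] exactly offsets the factor [1 - rho] of
   [exp_degree_le], so the mean penalty does not grow. *)
pose lam' := lam / th ^+ i.+1.
pose x j := gain j + (future i.+1 * #|alive (U :\: kill j)|%:R -
  Gam * \sum_(e in U :\: kill j) expR (lam' * (degree (U :\: kill j) e)%:R)).
have [j [wj xj]] : exists j, 0 < wt U b tau j /\
    future 0 * #|H|%:R - 1 - #|F|%:R <= x j.
  apply: exists_ge_average; first by exact: wt_ge0.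
    exact: wt_sum.
  apply: (@le_trans _ _ (future i * #|alive U|%:R - Gam *
      \sum_(e in U) expR (lam / th ^+ i * (degree U e)%:R))); first by lra.
  have -> : \sum_j wt U b tau j * x j = tau * #|alive U|%:R +
      future i.+1 * (\sum_j wt U b tau j * #|alive (U :\: kill j)|%:R) -
      Gam * \sum_j wt U b tau j *
        \sum_(e in U :\: kill j) expR (lam' * (degree (U :\: kill j) e)%:R).
    rewrite -(wt_gain U b) !mulr_sumr -sumrN -!big_split /=.
    by apply: eq_bigr => j _; rewrite /x; ring.
  rewrite futureS //; apply: lerB.
    have -> : (N * B * th ^+ i)^-1 = tau by rewrite /tau /b mulrA.
    rewrite mulrDl lerD2l mulrAC mulrC ler_wpM2l ?future_ge0 //.
    apply: le_trans (alive_kill_ge degb tau0 taub r_gt0 _); last by rewrite mulr_ge0 // ltW.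
    by rewrite taubN.
  rewrite ler_pM2l //.
  have -> : \sum_j wt U b tau j *
      \sum_(e in U :\: kill j) expR (lam' * (degree (U :\: kill j) e)%:R) =
      \sum_(e in U) \sum_j wt U b tau j *
        ((e \notin kill j)%:R * expR (lam' * (degree (U :\: kill j) e)%:R)).
    rewrite exchange_big /=; apply: eq_bigr => j _; rewrite -mulr_sumr; congr (_ * _).
    rewrite (eq_bigl (fun e => (e \in U) && (e \notin kill j))); last first.
      by move=> e; rewrite inE andbC.
    rewrite big_mkcondr; apply: eq_bigr => e _.
    by case: (e \in kill j); rewrite /= ?mul0r ?mul1r.
  apply: ler_sum => e eU.
  have -> : lam / th ^+ i = lam' * (1 - rho).
    by rewrite /lam' exprS -/th; field; rewrite ?expf_neq0 !gt_eqF ?exprn_gt0.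
  have thle : th ^+ t <= th ^+ i.+1 by rewrite ler_wiXn2l // ltW.
  have tht : 0 < th ^+ t by rewrite exprn_gt0.
  apply: (exp_degree_le degb tau0 taub r_gt0 (kap := kap)) => //.
  - by rewrite divr_ge0 // exprn_ge0 // ltW.
  - apply: le_trans lamC; rewrite ler_wpM2r ?mulr_ge0 // ler_wpM2l //.
    by rewrite lef_pV2 ?posrE ?exprn_gt0.
  rewrite -(ler_pM2r N0); apply: le_trans rhoN _; rewrite -[leRHS]mulrA ler_wpM2l ?subr_ge0 //.
  rewrite taubN mulrBl mulfVK ?gt_eqF // lerD2l lerN2 /tau.
  have -> : r%:R ^+ 2 * ((N * b)^-1 * C) * N = r%:R ^+ 2 * C / b.
    by field; rewrite !gt_eqF.
  rewrite ler_wpM2l ?mulr_ge0 ?exprn_ge0 // lef_pV2 ?posrE ?mulr_gt0 ?exprn_gt0 //.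
  by rewrite ler_pM2l // ler_wiXn2l ?(ltW th0) // ltnW.
case: j wj xj => [[K|f]|] wj xj; last first.
- exists F, U; split => //; move: xj; rewrite /x /= setD0; lra.
- exists F, (U :\ f); split => //.
  + by apply: subset_trans UV; exact: subD1set.
  + by move=> K /FU; apply: disjointWr; exact: subD1set.
  + by apply: leq_trans FUV; rewrite leq_add2l subset_leq_card ?subD1set.
  + by move: xj; rewrite /x /=; lra.
have KA : K \in alive U by move: wj => /=; case: ifP; rewrite ?ltxx.
move: (KA); rewrite inE => /andP[KH KU].
have KF : K \notin F.
  apply/negP => /FU; rewrite -setI_eq0 (setIidPl KU) => /eqP K0.
  by move: r_gt0; rewrite -(sr KH) K0 cards0.
exists (K |: F), (U :\: s K); split.
- split; first by apply/subsetP => L; rewrite !inE => /orP[/eqP ->|/(subsetP FH)].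
  move=> K1 K2; rewrite !inE => /orP[/eqP ->|K1F] /orP[/eqP ->|K2F].
  + by rewrite eqxx.
  + by move=> _; rewrite disjoint_sym; apply: disjointWr (FU _ K2F).
  + by move=> _; apply: disjointWr (FU _ K1F).
  + exact: packF.
- by apply: subset_trans UV; exact: subsetDl.
- move=> L; rewrite !inE => /orP[/eqP ->|LF].
    by rewrite disjoint_sym disjoints_subset setDE subsetIr.
  by apply: disjointWr (FU _ LF); exact: subsetDl.
- apply: leq_trans FUV; rewrite cardsU1 KF /= add1n addSnnS leq_add2l.
  by rewrite -[leqRHS](cardsID (s K) U) (setIidPr KU) (sr KH) -add1n leq_add2r.
- by move: xj; rewrite /x /= cardsU1 KF add1n -natr1; lra.
Qed.

Lemma nibble : exists F : {set I}, [/\ F \subset H, packing F &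
  #|H|%:R / (N * B) * (\sum_(i < t) ((1 - r%:R / N) / th) ^+ i) - 1 <= #|F|%:R].
Proof.
have fut0 : #|H|%:R / (N * B) * (\sum_(i < t) ((1 - r%:R / N) / th) ^+ i) =
    future 0 * #|H|%:R.
  rewrite /future subn0 mulr_suml mulr_sumr; apply: eq_bigr => i _.
  by rewrite expr_div_n add0n; field; rewrite expf_neq0 !gt_eqF.
rewrite fut0; case: (leP 0 (future 0 * #|H|%:R - 1)) => Psi0; last first.
  exists set0; rewrite sub0set cards0; split => //; last exact: ltW.
  by move=> ? ?; rewrite inE.
have [F [U [[FH packF] _ _ _ Psi]]] := nibble_invariant (leqnn t) Psi0.
exists F; split => //; apply: le_trans Psi _.
rewrite /future subnn big_ord0 mul0r addr0 gerBl mulr_ge0 ?(ltW Gam0) //.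
by apply: sumr_ge0 => e _; rewrite expR_ge0.
Qed.

End Run.
End Nibble.

(** * Numerical estimates and the choice of parameters *)

Lemma one_sub_expRN_ge (R : realType) (x : R) : 0 <= x <= 1 ->
  55 / 100 * x <= 1 - expR (- x).
Proof.
move=> /andP[x0 x1].
(* The best constant would be [1 - expR (- 1)], about 0.63. Squaring the linear bound at [x / 2]
   already yields 0.55, which is enough for the factor 1/2 in the end. *)
have h : (1 + x / 2) ^+ 2 <= expR x.
  have -> : expR x = expR (x / 2) ^+ 2 by rewrite expr2 -expRD; congr expR; field.
  by rewrite lerXn2r ?nnegrE ?expR_ge0 ?expR_ge1Dx //; lra.
have e0 := expR_gt0 x.
rewrite expRN -(ler_pM2r e0) mulrBl mul1r mulVf ?gt_eqF //.
have : (1 - 55 / 100 * x) * (1 + x / 2) ^+ 2 <=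
    (1 - 55 / 100 * x) * expR x by rewrite ler_wpM2l //; lra.
have : 1 <= (1 - 55 / 100 * x) * (1 + x / 2) ^+ 2.
  have -> : (1 - 55 / 100 * x) * (1 + x / 2) ^+ 2 =
    1 + x * (45 / 100 - 3 / 10 * x - 11 / 80 * x ^+ 2) by field.
  rewrite lerDl mulr_ge0 //.
  have : x ^+ 2 <= 1 by rewrite expr_le1.
  by lra.
by lra.
Qed.

(** As [t] may be as large as [N], the decay cannot be neglected: [1 - y ^ t] is bounded through
    [y ^ t <= expR (- t / N)], which uses [1 <= a]. *)
Lemma geometric_sum_ge (R : realType) (N a z : R) (t : nat) :
  1 <= a -> 0 < N -> a <= N -> t%:R <= N -> 1 - a / N <= z ->
  55 / 100 * t%:R / a <= \sum_(i < t) z ^+ i.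
Proof.
move=> a1 N0 aN tN zge.
have a0 : 0 < a by lra.
pose y := 1 - a / N.
have aN1 : a / N <= 1 by rewrite ler_pdivrMr // mul1r.
have aN0 : 0 < a / N by rewrite divr_gt0.
have y0 : 0 <= y by rewrite /y; lra.
apply: (@le_trans _ _ (\sum_(i < t) y ^+ i)); last first.
  apply: ler_sum => i _; rewrite lerXn2r ?nnegrE //.
  exact: le_trans zge.
have -> : \sum_(i < t) y ^+ i = (1 - y ^+ t) * (N / a).
  have := subrX1 y t => h.
  have -> : 1 - y ^+ t = (a / N) * \sum_(i < t) y ^+ i.
    by rewrite -opprB h /y; ring.
  by field; rewrite !gt_eqF.
have yt : y ^+ t <= expR (- (t%:R / N)).
  apply: (@le_trans _ _ (expR (- (N^-1)) ^+ t)).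
    rewrite lerXn2r ?nnegrE ?expR_ge0 //.
    apply: le_trans (expR_ge1Dx _); rewrite /y lerD2l lerN2.
    by rewrite -[leLHS]mul1r ler_pM2r ?invr_gt0.
  by rewrite -expRM_natl mulrN.
have := @one_sub_expRN_ge R (t%:R / N).
rewrite divr_ge0 // ?(ltW N0) // ler_pdivrMr // mul1r tN => /(_ isT) h.
have -> : 55 / 100 * t%:R / a = 55 / 100 * (t%:R / N) * (N / a).
  by field; rewrite !gt_eqF.
rewrite ler_pM2r ?divr_gt0 //; lra.
Qed.

(** On [[0, 1/2]] one has [1 - rho >= expR (- 2 * rho)]; this crude factor 2 is the one in
    [expR (2 * sig * q)]. *)
Lemma survival_ge (R : realType) (rho q sig N g : R) (t : nat) :
  0 <= rho <= 2^-1 -> rho * N <= q -> 0 < sig -> t%:R <= sig * N ->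
  expR (2 * sig * q) <= g ^+ 2 -> 1 <= (1 - rho) ^+ t * g ^+ 2.
Proof.
move=> /andP[rho0 rho1] rhoN sig0 t1 expg.
have h1 : expR (- (2 * rho)) <= 1 - rho.
  rewrite expRN -[leLHS]mul1r ler_pdivrMr ?expR_gt0 //.
  have := expR_ge1Dx (2 * rho); move: (expR _) => e he.
  have : (1 - rho) * (1 + 2 * rho) <= (1 - rho) * e by rewrite ler_wpM2l //; lra.
  have : 0 <= rho * (1 - 2 * rho) by rewrite mulr_ge0 //; lra.
  by lra.
have h2 : expR (- (2 * sig * q)) <= (1 - rho) ^+ t.
  apply: (@le_trans _ _ (expR (- (2 * rho)) ^+ t)).
    rewrite -expRM_natl ler_expR mulrN lerN2.
    have : rho * t%:R <= rho * (sig * N) by rewrite ler_wpM2l.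
    have : sig * (rho * N) <= sig * q by rewrite ler_pM2l.
    by lra.
  by rewrite lerXn2r ?nnegrE ?expR_ge0 //; lra.
apply: (@le_trans _ _ (expR (- (2 * sig * q)) * expR (2 * sig * q))).
  by rewrite -expRD addNr expR0.
by apply: ler_pM; rewrite ?expR_ge0.
Qed.

(** Two errors of at most 1/100 each: [kap * (q - 1)] from linearizing the exponential, and the
    codegree term of [loss_ge]. *)
Lemma nibble_rate (R : realType) (q g kap D0 B Th : R) :
  3 <= q -> 100 * q ^+ 2 <= g -> kap * q = 100^-1 -> 0 < kap <= 300^-1 ->
  0 < D0 -> D0 <= B -> 0 < Th -> 1 <= Th * g ^+ 2 ->
  q - 1 - 2 / 100 <= (1 - kap) * (q - 1 - q ^+ 2 * (D0 / g ^+ 5) / (B * Th)).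
Proof.
move=> q3 gq kq /andP[kap0 kap1] D0p DB Th0 Thg.
have g1 : 1 <= g.
  have : q <= q ^+ 2 by rewrite -[leLHS]expr1 ler_weXn2l //; lra.
  by lra.
have g0 : 0 < g by lra.
have B0 : 0 < B by lra.
set X := _ / (B * Th).
have X1 : X <= 100^-1.
  have -> : X = q ^+ 2 / g ^+ 3 * (D0 / B) * (Th * g ^+ 2)^-1.
    by rewrite /X; field; rewrite !gt_eqF.
  have a1 : q ^+ 2 / g ^+ 3 <= 100^-1.
    rewrite ler_pdivrMr ?exprn_gt0 //.
    have : g <= g ^+ 3 by rewrite -[leLHS]expr1 ler_weXn2l.
    by lra.
  have a2 : D0 / B <= 1 by rewrite ler_pdivrMr // mul1r.
  have a3 : (Th * g ^+ 2)^-1 <= 1 by rewrite invf_le1 // (lt_le_trans _ Thg).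
  apply: (@le_trans _ _ (100^-1 * 1 * 1)); last by rewrite !mulr1.
  have b1 : 0 <= q ^+ 2 / g ^+ 3 by rewrite divr_ge0 ?exprn_ge0 ?(ltW g0) //; lra.
  have b2 : 0 <= D0 / B by rewrite divr_ge0 // ltW.
  have b3 : 0 <= (Th * g ^+ 2)^-1 by rewrite invr_ge0 mulr_ge0 ?exprn_ge0 ?(ltW g0) ?(ltW Th0).
  by apply: ler_pM => //; [rewrite mulr_ge0 | apply: ler_pM].
have : (1 - kap) * (q - 1 - 100^-1) <= (1 - kap) * (q - 1 - X).
  by rewrite ler_wpM2l //; lra.
by lra.
Qed.

(** Supplies [lamBD]. The polynomial factors are at most [2 * N ^ 2 * g ^ 2 <= expR (7 * g) <= expR
    (g ^ 2)], so a gap of [g ^ 2] between [lam * D] and [lam * B] suffices. *)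
Lemma nibble_failure (R : realType) (N h g B D Th lam : R) (t : nat) :
  0 < N -> 0 <= h <= N * B -> 0 < B -> 0 < Th -> 1 <= Th * g ^+ 2 ->
  t%:R <= N -> 7 <= g -> N <= expR (2 * g) -> lam * D + g ^+ 2 <= lam * B ->
  (N + t%:R * h / (N * B * Th)) * N * expR (lam * D) <= expR (lam * B).
Proof.
move=> N0 /andP[h0 hB] B0 Th0 Thg tN g7 Nexp a3.
have g0 : 0 < g by lra.
have NB : 0 < N * B by rewrite mulr_gt0.
have ThV : Th^-1 <= g ^+ 2 by rewrite -[leLHS]mul1r ler_pdivrMr // mulrC.
have g2 : 1 <= g ^+ 2 by rewrite -[leLHS](expr1n _ 2) lerXn2r ?nnegrE ?(ltW g0) //; lra.
have a1 : t%:R * h / (N * B * Th) <= N * g ^+ 2.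
  have -> : t%:R * h / (N * B * Th) = t%:R * ((h / (N * B)) * Th^-1).
    by field; rewrite !gt_eqF.
  apply: ler_pM => //; first by rewrite mulr_ge0 ?invr_ge0 ?divr_ge0 // ltW.
  rewrite -[leRHS]mul1r; apply: ler_pM; rewrite ?divr_ge0 ?invr_ge0 ?(ltW NB) ?(ltW Th0) //.
  by rewrite ler_pdivrMr // mul1r.
have a2 : N + t%:R * h / (N * B * Th) <= 2 * (N * g ^+ 2).
  have : N * 1 <= N * g ^+ 2 by rewrite ler_pM2l.
  by lra.
have a4 : 2 * (N * g ^+ 2) * N <= expR (g ^+ 2).
  have eg : g <= expR g by have := expR_ge1Dx g; lra.
  apply: (@le_trans _ _ (expR g * (expR (2 * g) * expR g ^+ 2) * expR (2 * g))).
    apply: ler_pM; rewrite ?mulr_ge0 ?exprn_ge0 ?(ltW N0) ?(ltW g0) //.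
    apply: ler_pM; rewrite ?mulr_ge0 ?exprn_ge0 ?(ltW N0) ?(ltW g0) //; first by lra.
    apply: ler_pM; rewrite ?exprn_ge0 ?(ltW N0) ?(ltW g0) //.
    by rewrite lerXn2r ?nnegrE ?expR_ge0 // ltW.
  rewrite -expRM_natl -!expRD ler_expR expr2.
  have : 7 * g <= g * g by rewrite ler_pM2r.
  by lra.
apply: (@le_trans _ _ (expR (g ^+ 2) * expR (lam * D))); last first.
  by rewrite -expRD ler_expR addrC.
rewrite ler_pM2r ?expR_gt0 //; apply: le_trans a4.
by rewrite ler_pM2r.
Qed.

(** Hyperedges decay at rate [q / N] and the degree ceiling at [(q - 1 - 2 / 100) / N], so the gain
    per step decays only at rate about [1 / N], independently of [q]. Numerically,
    [96 / 100 * (55 / 103)] exceeds 1/2, and [sig * W / q >= 200] lets the excess pay for the [- 1]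
    and for rounding [t]. *)
Lemma nibble_gain (R : realType) (N q W D0 h kap rho sig : R) (t : nat) :
  3 <= q -> 103 * q <= N -> 99 / 100 * W <= N <= 101 / 100 * W -> 0 < D0 ->
  0 < kap <= 300^-1 -> 97 / 100 * (D0 * W) <= q * h -> 0 <= h ->
  rho * N = q - 1 - 2 / 100 -> rho < 1 -> 200 * q <= sig * W ->
  t%:R <= N -> sig * N - 1 <= t%:R ->
  sig * W / (2 * q) <= h / (N * ((1 + kap) * ((1 + kap) * D0))) *
    \sum_(i < t) ((1 - q / N) / (1 - rho)) ^+ i - 1.
Proof.
move=> q3 Nq /andP[NW WN] D0p /andP[kap0 kap1] hge h0 rhoN rho1 sW tN tge.
have q0 : 0 < q by lra.
have N0 : 0 < N by lra.
have W0 : 0 < W by lra.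
have zge : 1 - (103 / 100) / N <= (1 - q / N) / (1 - rho).
  rewrite ler_pdivlMr ?subr_gt0 //.
  rewrite -(ler_pM2r N0) -[leLHS]mulrA.
  have -> : (1 - rho) * N = N - q + 1 + 2 / 100 by rewrite mulrBl rhoN; ring.
  have -> : (1 - q / N) * N = N - q by field; rewrite gt_eqF.
  have -> : (1 - 103 / 100 / N) * (N - q + 1 + 2 / 100) =
     (N - q + 1 + 2 / 100) - 103 / 100 * (1 - (q - 1 - 2 / 100) / N).
    by field; rewrite gt_eqF.
  have : (q - 1 - 2 / 100) / N <= 103^-1 by rewrite ler_pdivrMr //; lra.
  by lra.
have zsum := @geometric_sum_ge R N (103 / 100) _ t _ N0 _ tN zge.
set Sz := \sum_(i < t) _ in zsum *.
have {}zsum : 55 / 100 * t%:R / (103 / 100) <= Sz by apply: zsum; lra.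
set B := (1 + kap) * _.
have BB : B <= (1 + 300^-1) * ((1 + 300^-1) * D0).
  rewrite /B; apply: ler_pM => //; first by lra.
  - by rewrite mulr_ge0 //; lra.
  - by lra.
  by apply: ler_pM => //; lra.
have B0 : 0 < B by rewrite /B !mulr_gt0 //; lra.
have hBge : 96 / 100 * (W / q) <= h / B.
  rewrite ler_pdivlMr // (_ : _ * B = 96 / 100 * W * B / q); last by ring.
  rewrite ler_pdivrMr //.
  have W0' : 0 <= 96 / 100 * W by lra.
  have := ler_wpM2l W0' BB.
  have : 0 < D0 * W by rewrite mulr_gt0.
  by move: hge; clear; lra.
have tge' : sig - N^-1 <= t%:R / N.
  by rewrite ler_pdivlMr // mulrBl mulVf ?gt_eqF.
have Wq0 : 0 < W / q by rewrite divr_gt0.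
have fin : 96 / 100 * (W / q) * (55 / 103 * (sig - N^-1)) <=
    h / B * (55 / 103 * (t%:R / N)).
  apply: (@le_trans _ _ (96 / 100 * (W / q) * (55 / 103 * (t%:R / N)))).
    rewrite ler_pM2l; last by rewrite mulr_gt0 //; lra.
    by rewrite ler_pM2l //; lra.
  by rewrite ler_wpM2r // mulr_ge0 ?divr_ge0 ?(ltW N0) //; lra.
have e1 : h / B * (55 / 103 * (t%:R / N)) <= h / (N * B) * Sz.
  have -> : h / B * (55 / 103 * (t%:R / N)) =
     h / (N * B) * (55 / 100 * t%:R / (103 / 100)).
    by field; rewrite !gt_eqF.
  by rewrite ler_wpM2l // divr_ge0 // mulr_ge0 // ltW.
have e2 : W / q / N <= 1.
  rewrite ler_pdivrMr // mul1r ler_pdivrMr //.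
  have : N * 3 <= N * q by rewrite ler_pM2l.
  by lra.
have e3 : 200 <= sig * (W / q) by rewrite mulrA ler_pdivlMr.
have -> : sig * W / (2 * q) = 2^-1 * (sig * (W / q)) by field; rewrite gt_eqF.
have e4 : W / q * (sig - N^-1) = sig * (W / q) - W / q / N by ring.
have e5 : 96 / 100 * (W / q) * (55 / 103 * (sig - N^-1)) =
  (96 / 100 * (55 / 103)) * (sig * (W / q) - W / q / N) by rewrite -e4; ring.
by move: fin e1 e2 e3; rewrite e5; clear; lra.
Qed.

(* The parameters of [nibble] are fixed so that vertices survive with
   probability about [expR (- sig)], while degrees drop by at most [g ^+ 2]. *)
Lemma nearly_regular_packing (R : realType) (T I : finType) (s : I -> {set T})
    (V : {set T}) (H : {set I}) (r : nat) (D0 g sig W : R) :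
  (3 <= r)%N ->
  (forall K, K \in H -> #|s K| = r) -> (forall K, K \in H -> s K \subset V) ->
  0 < D0 ->
  (forall e, (degree s H V e)%:R <= (1 + (100 * r%:R)^-1) * D0) ->
  (forall e f, e != f -> (codegree s H e f)%:R <= D0 / g ^+ 5) ->
  97 / 100 * (D0 * W) <= r%:R * #|H|%:R ->
  100 ^+ 2 * r%:R ^+ 3 <= g -> g <= W -> #|V|%:R <= expR (2 * g) ->
  99 / 100 * W <= #|V|%:R <= 101 / 100 * W ->
  0 < sig <= 1 -> 200 * r%:R <= sig * W -> expR (2 * sig * r%:R) <= g ^+ 2 ->
  exists F : {set I},
    [/\ F \subset H, packing s F & sig * W / (2 * r%:R) <= #|F|%:R].
Proof.
move=> r3n sr sV D0p degD codC Hge rg gW Nexp NW /andP[sig0 sig1] sW expg.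
have q3 : 3 <= r%:R :> R by rewrite ler_nat.
have HB : r%:R * #|H|%:R <= #|V|%:R * ((1 + (100 * r%:R)^-1) * D0).
  have HE : alive s H V = H.
    by apply/setP => K; rewrite inE; case: (boolP (K \in H)) => // /sV ->.
  rewrite -{1}HE -(sum_degree R sr) mulr_natl -sumr_const.
  by apply: ler_sum => e _; exact: degD.
have nib := @nibble R T I s V H r (D0 / g ^+ 5) sr _ codC
  ((1 + (100 * r%:R)^-1) * D0) _ _ _ _ _ (ltn_trans (isT : 0 < 2)%N r3n) _ sV
  (fun e _ => degD e).
move: nib q3 HB Hge rg Nexp NW sW expg; rewrite -(ler_nat R r).
set N : R := #|V|%:R; set q : R := r%:R; set h : R := #|H|%:R.
have h0 : 0 <= h by [].
clearbody N q h.
move=> nib q3 HB Hge rg Nexp NW sW expg.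
have q0 : 0 < q by lra.
have qqq : q ^+ 2 <= q ^+ 3 by rewrite ler_weXn2l //; lra.
have gq2 : 100 * q ^+ 2 <= g.
  have : 0 <= q ^+ 2 by rewrite exprn_ge0 ?ltW.
  by move: rg; rewrite [100 ^+ 2]expr2; lra.
have qq : 3 * q <= q ^+ 2 by rewrite expr2 ler_pM2r.
have gq : 300 * q <= g by lra.
have g1 : 900 <= g by lra.
have g0 : 0 < g by lra.
have Nq : 103 * q <= N by case/andP: NW; lra.
have N0 : 0 < N by lra.
set kap := (100 * q)^-1 in nib HB.
have kq : kap * q = 100^-1 by rewrite /kap; field; rewrite gt_eqF.
have kap0 : 0 < kap by rewrite invr_gt0 mulr_gt0.
have kap1 : kap <= 300^-1.
  by rewrite lef_pV2 ?posrE ?mulr_gt0 //; lra.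
have kD : 0 < kap * D0 by rewrite mulr_gt0.
(* The second factor [1 + kap] is the room between the initial degrees and the ceiling. *)
pose D := (1 + kap) * D0; pose B := (1 + kap) * D.
have DD0 : D0 <= D by rewrite /D mulrDl mul1r lerDl ltW.
have D_gt0 : 0 < D by exact: lt_le_trans DD0.
have BD : D + kap * D0 <= B by rewrite /B mulrDl mul1r lerD2l ler_pM2l.
have DB : D <= B by apply: le_trans BD; rewrite lerDl ltW.
have B0 : 0 < B by exact: lt_le_trans DB.
pose rho := (q - 1 - 2 / 100) / N.
have rhoN : rho * N = q - 1 - 2 / 100 by rewrite /rho mulfVK // gt_eqF.
have rho01 : 0 <= rho <= 2^-1.
  apply/andP; split; first by rewrite divr_ge0 ?(ltW N0) //; move: q3; clear; lra.
  by rewrite ler_pdivrMr //; move: q3 Nq; clear; lra.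
have rho1 : rho < 1 by case/andP: rho01; clear; lra.
pose t := Num.truncn (sig * N).
have sN0 : 0 <= sig * N by rewrite mulr_ge0 ?ltW.
have /andP[t1 t2] := truncn_itv sN0; rewrite -/t -natr1 in t1 t2.
have tN : t%:R <= N by apply: le_trans t1 _; rewrite ler_piMl // ltW.
set Th := (1 - rho) ^+ t.
have Th0 : 0 < Th by rewrite exprn_gt0 // subr_gt0.
have Thg : 1 <= Th * g ^+ 2.
  by apply: (@survival_ge R rho q sig N) => //; rewrite rhoN; move: q3; clear; lra.
(* Large enough that [lam * (B - D) >= g ^ 2], by [100 ^ 2 * q ^ 3 <= g]; small enough that
   [lam / Th * q * (D0 / g ^ 5) <= kap], by [1 / Th <= g ^ 2]. *)
pose lam := g ^+ 3 / (100 * q ^+ 2 * D0).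
have lam0 : 0 <= lam.
  by rewrite divr_ge0 ?mulr_ge0 ?exprn_ge0 ?(ltW g0) ?(ltW q0) ?(ltW D0p).
have [|||||||||F [FH packF Fge]] := nib _ B lam kap rho t _.
- by rewrite divr_ge0 ?exprn_ge0 ?(ltW g0) ?(ltW D0p).
- by move: Nq q3; clear; lra.
- exact: B0.
- by case/andP: rho01 => -> _; rewrite rho1.
- exact: lam0.
- by move: kap1; clear; lra.
- have -> : lam / Th * (q * (D0 / g ^+ 5)) = kap * (Th * g ^+ 2)^-1.
    by rewrite /lam /kap; field; rewrite !gt_eqF.
  by rewrite ler_piMr ?(ltW kap0) // invf_le1 // (lt_le_trans _ Thg).
- rewrite -/Th rhoN; apply: nibble_rate => //; first by rewrite kap0.
  exact: le_trans DB.
- apply: (@nibble_failure R N h g B D Th lam t) => //; last first.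
  + apply: (@le_trans _ _ (lam * (D + kap * D0))); last by rewrite ler_wpM2l.
    rewrite mulrDr lerD2l.
    have -> : lam * (kap * D0) = g ^+ 2 * (g / (100 ^+ 2 * q ^+ 3)).
      by rewrite /lam /kap; field; rewrite !gt_eqF.
    rewrite ler_peMr ?exprn_ge0 ?(ltW g0) // ler_pdivlMr ?mul1r //.
    by rewrite mulr_gt0 ?exprn_gt0.
  + by move: g1; clear; lra.
  rewrite h0 /=; apply: (@le_trans _ _ (N * D)); last by rewrite ler_pM2l.
  apply: le_trans HB; rewrite ler_peMl //; move: q3; clear; lra.
exists F; split => //; apply: le_trans Fge.
apply: (nibble_gain _ _ NW) => //; first by rewrite kap0.
by move: t2; clear; lra.
Qed.

(** * Moments of clique counts in G(n, p) *)

Section Gnp.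
Variables (R : realType) (n : nat) (p : R).
Hypothesis p01 : 0 <= p <= 1.

Local Notation edges := (pairs_of [set: 'I_n]).

Definition Gnp_mean (X : {set {set 'I_n}} -> R) : R :=
  \sum_(G : {set {set 'I_n}} | is_graph G) Gnp_weight p G * X G.

Lemma Gnp_weight_ge0 (G : {set {set 'I_n}}) : 0 <= Gnp_weight p G.
Proof.
case/andP: p01 => p0 p1; apply: prodr_ge0 => e _; case: ifP => // _.
by rewrite subr_ge0.
Qed.

Lemma Gnp_mean_sub (F : {set {set 'I_n}}) : F \subset edges ->
  Gnp_mean (fun G => (F \subset G)%:R) = p ^+ #|F|.
Proof.
move=> FE.
(* In the expansion of the product over all sets [G], [a] kills the [G] that are not graphs and [b]
   kills those that miss an element of [F]; the surviving terms are the weights. *)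
pose a e : R := if e \in edges then p else 0.
pose b e : R := if e \in edges then (if e \in F then 0 else 1 - p) else 1.
transitivity (\prod_e (a e + b e)).
  rewrite bigA_distr /Gnp_mean big_mkcond; apply: eq_bigr => G _.
  case: ifPn => [GE|]; last first.
    case/subsetPn => e eG eE; rewrite (bigD1 e) //= eG /a (negbTE eE) mul0r //.
  case: (boolP (F \subset G)) => [FG|/subsetPn[e eF eG]].
    rewrite mulr1 /Gnp_weight [LHS]big_mkcond; apply: eq_bigr => e _.
    rewrite /a /b; case: ifP => eE; last first.
      by case: ifP => // /(subsetP GE); rewrite eE.
    by case: (boolP (e \in G)) => // eG; rewrite ifN // (contra (subsetP FG e)).
  rewrite mulr0 [RHS](bigD1 e) //= (negbTE eG) /b eF (subsetP FE) //.
  by rewrite mul0r.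
rewrite -prodr_const [RHS]big_mkcond; apply: eq_bigr => e _; rewrite /a /b.
case: ifP => eE; case: ifP => eF; rewrite ?addr0 ?add0r //.
- by rewrite addrC subrK.
- by move/(subsetP FE): eF; rewrite eE.
Qed.

Lemma Gnp_mean_sum (J : finType) (P : pred J) (X : J -> {set {set 'I_n}} -> R) :
  Gnp_mean (fun G => \sum_(j | P j) X j G) = \sum_(j | P j) Gnp_mean (X j).
Proof.
by rewrite /Gnp_mean exchange_big /=; apply: eq_bigr => G _; rewrite mulr_sumr.
Qed.

Lemma Gnp_meanZ c (X : {set {set 'I_n}} -> R) :
  Gnp_mean (fun G => c * X G) = c * Gnp_mean X.
Proof. by rewrite mulr_sumr; apply: eq_bigr => G _; rewrite mulrCA. Qed.

Lemma Gnp_meanD (X Y : {set {set 'I_n}} -> R) :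
  Gnp_mean (fun G => X G + Y G) = Gnp_mean X + Gnp_mean Y.
Proof. by rewrite -big_split; apply: eq_bigr => G _; rewrite mulrDr. Qed.

Lemma eq_Gnp_mean (X Y : {set {set 'I_n}} -> R) :
  (forall G, is_graph G -> X G = Y G) -> Gnp_mean X = Gnp_mean Y.
Proof. by move=> XY; apply: eq_bigr => G gG; rewrite XY. Qed.

Lemma le_Gnp_mean (X Y : {set {set 'I_n}} -> R) :
  (forall G, is_graph G -> X G <= Y G) -> Gnp_mean X <= Gnp_mean Y.
Proof.
by move=> XY; apply: ler_sum => G gG; rewrite ler_wpM2l ?Gnp_weight_ge0 // XY.
Qed.

Lemma Gnp_mean1 : Gnp_mean (fun=> 1) = 1.
Proof.
rewrite -[RHS](expr0 p) -(cards0 {set 'I_n}) -Gnp_mean_sub ?sub0set //.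
by apply: eq_Gnp_mean => G _; rewrite sub0set.
Qed.

Lemma Gnp_mean_cst c : Gnp_mean (fun=> c) = c.
Proof.
rewrite -[RHS]mulr1 -Gnp_mean1 -Gnp_meanZ.
by apply: eq_Gnp_mean => G _; rewrite mulr1.
Qed.

Lemma Gnp_probE (A : pred {set {set 'I_n}}) :
  Gnp_prob p A = Gnp_mean (fun G => (A G)%:R).
Proof.
rewrite /Gnp_prob /Gnp_mean big_mkcondr; apply: eq_bigr => G _.
by case: (A G); rewrite ?mulr1 ?mulr0.
Qed.

Lemma Gnp_prob_le1 (A : pred {set {set 'I_n}}) : Gnp_prob p A <= 1.
Proof.
by rewrite Gnp_probE -[leRHS]Gnp_mean1; apply: le_Gnp_mean => G _; rewrite lern1 leq_b1.
Qed.

(** Pointwise, the indicator of [A] plus [X / x + Y / y + Z / z] is at least 1 on graphs; take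
    means. *)
Lemma Gnp_prob_ge_markov (A : pred {set {set 'I_n}})
    (X Y Z : {set {set 'I_n}} -> R) (x y z : R) :
  (forall G, 0 <= X G) -> (forall G, 0 <= Y G) -> (forall G, 0 <= Z G) ->
  0 < x -> 0 < y -> 0 < z ->
  (forall G, is_graph G -> X G <= x -> Y G <= y -> Z G <= z -> A G) ->
  1 - Gnp_mean X / x - Gnp_mean Y / y - Gnp_mean Z / z <= Gnp_prob p A.
Proof.
move=> X0 Y0 Z0 x0 y0 z0 XYZ.
rewrite Gnp_probE !lerBlDr -[leLHS]Gnp_mean1.
have E W w : Gnp_mean W / w = Gnp_mean (fun G => w^-1 * W G).
  by rewrite Gnp_meanZ mulrC.
rewrite !E -!Gnp_meanD; apply: le_Gnp_mean => G gG.
have tail (W : {set {set 'I_n}} -> R) w : (forall G, 0 <= W G) -> 0 < w ->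
    0 <= w^-1 * W G /\ (~~ (W G <= w) -> 1 <= w^-1 * W G).
  move=> W0 w0; split; first by rewrite mulr_ge0 // invr_ge0 ltW.
  by rewrite -ltNge mulrC ler_pdivlMr // mul1r => /ltW.
have [x1 x2] := tail X x X0 x0; have [y1 y2] := tail Y y Y0 y0.
have [z1 z2] := tail Z z Z0 z0.
have A0 : 0 <= (A G)%:R :> R by [].
case: (boolP (X G <= x)) => hx; last by have := x2 hx; lra.
case: (boolP (Y G <= y)) => hy; last by have := y2 hy; lra.
case: (boolP (Z G <= z)) => hz; last by have := z2 hz; lra.
by rewrite XYZ // mulr1n; lra.
Qed.

End Gnp.

(** * Counting vertex sets by intersection *)

Lemma card_pairs_of (n : nat) (K : {set 'I_n}) : #|pairs_of K| = 'C(#|K|, 2).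
Proof. exact: cards_draws. Qed.

Lemma pairs_ofI (n : nat) (K L : {set 'I_n}) :
  pairs_of K :&: pairs_of L = pairs_of (K :&: L).
Proof.
by apply/setP => e; rewrite !inE subsetI; case: (#|e| == 2%N); rewrite ?andbT ?andbF.
Qed.

Lemma pairs_of_sub (n : nat) (K L : {set 'I_n}) :
  K \subset L -> pairs_of K \subset pairs_of L.
Proof.
move=> KL; apply/subsetP => e; rewrite !inE => /andP[eK ->].
by rewrite (subset_trans eK).
Qed.

Lemma card_inter_le (n k j : nat) (K : {set 'I_n}) :
  (#|[set L : {set 'I_n} | (#|L| == k) && (#|L :&: K| == j)]| <=
   'C(#|K|, j) * 'C(n - #|K|, k - j))%N.
Proof.
pose f (L : {set 'I_n}) := (L :&: K, L :\: K).
have finj : injective f by move=> L M [h1 h2]; rewrite -(setID L K) h1 h2 setID.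
rewrite -(card_imset _ finj) -cards_draws.
have -> : (n - #|K|)%N = #|~: K| by rewrite [RHS]cardsCs setCK card_ord.
rewrite -cards_draws -cardsX; apply: subset_leq_card.
apply/subsetP => _ /imsetP[L + ->]; rewrite !inE /= subsetIr.
case/andP=> /eqP Lk /eqP Lj; rewrite Lj eqxx setDE subsetIr -setDE /=.
by rewrite cardsD Lk Lj.
Qed.

Lemma card_over_le (n k : nat) (A : {set 'I_n}) :
  (#|[set L : {set 'I_n} | (#|L| == k) && (A \subset L)]| <=
   'C(n - #|A|, k - #|A|))%N.
Proof.
apply: leq_trans (_ : 'C(#|A|, #|A|) * 'C(n - #|A|, k - #|A|) <= _)%N; last first.
  by rewrite binn mul1n.
apply: leq_trans (card_inter_le k #|A| A); apply: subset_leq_card.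
apply/subsetP => L; rewrite !inE => /andP[-> /setIidPr ->]; exact: eqxx.
Qed.

(** * Second moments of clique degrees, overlaps and edge count *)

Section CliqueMoments.
Variables (R : realType) (n k : nat) (p : R).
Hypothesis p01 : 0 < p <= 1.
Hypothesis n2 : (2 <= n)%N.
Hypothesis k2 : (2 <= k)%N.

Let p0 : 0 < p. Proof. by case/andP: p01. Qed.
Let p01' : 0 <= p <= 1. Proof. by case/andP: p01 => /ltW -> ->. Qed.

Local Notation edges := (pairs_of [set: 'I_n]).
Local Notation r := 'C(k, 2).
Local Notation N0 := 'C(n, 2).
Local Notation mean := (Gnp_mean p).

Definition ksets : {set {set 'I_n}} := [set K : {set 'I_n} | #|K| == k].

Local Notation mu := (expected_kcliques p n k).

(** By [bin_pairs] this is ['C(n - 2, k - 2) * p ^ (r - 1)], the mean number of cliques through an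
    edge given that the edge is present. *)
Definition mean_degree : R := r%:R * mu / (p * N0%:R).

Local Notation D0 := mean_degree.

Definition clique_degree (G : {set {set 'I_n}}) (e : {set 'I_n}) : R :=
  \sum_(K in ksets) ((e \in pairs_of K) && (pairs_of K \subset G))%:R.

(** The indicator of [e \in G] centers at the conditional mean: an absent pair has clique degree 0
    and contributes nothing. *)
Definition degree_deviation (G : {set {set 'I_n}}) : R :=
  \sum_(e in edges) (clique_degree G e - D0 * (e \in G)%:R) ^+ 2.

(** Serves twice: its mean bounds that of [degree_deviation], and its value bounds the number of
    cliques with two edges of large codegree. *)
Definition overlap (G : {set {set 'I_n}}) : R :=
  \sum_(K in ksets) \sum_(L in ksets | (2 < #|K :&: L|)%N)
    'C(#|K :&: L|, 2)%:R ^+ 2 * (pairs_of K :|: pairs_of L \subset G)%:R.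

Definition edge_deviation (G : {set {set 'I_n}}) : R :=
  (#|G|%:R - p * N0%:R) ^+ 2.

Definition overlap_mean : R :=
  \sum_(K in ksets) \sum_(L in ksets | (2 < #|K :&: L|)%N)
    'C(#|K :&: L|, 2)%:R ^+ 2 * p ^+ (2 * r - 'C(#|K :&: L|, 2)).

Lemma card_ksets : #|ksets| = 'C(n, k).
Proof. by rewrite /ksets card_draws card_ord. Qed.

Lemma card_edges : #|edges| = N0.
Proof. by rewrite card_pairs_of cardsT card_ord. Qed.

Lemma pairs_of_edges (K : {set 'I_n}) : pairs_of K \subset edges.
Proof. by apply: pairs_of_sub; exact: subsetT. Qed.

Lemma card_kpairs K : K \in ksets -> #|pairs_of K| = r.
Proof. by rewrite inE card_pairs_of => /eqP ->. Qed.

Lemma mean_union K L : K \in ksets -> L \in ksets ->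
  mean (fun G => (pairs_of K :|: pairs_of L \subset G)%:R) =
  p ^+ (2 * r - 'C(#|K :&: L|, 2)).
Proof.
move=> Kk Lk; rewrite Gnp_mean_sub ?subUset ?pairs_of_edges //.
by rewrite cardsU !card_kpairs // addnn mul2n pairs_ofI card_pairs_of.
Qed.

Lemma mean_overlap : mean overlap = overlap_mean.
Proof.
rewrite /overlap Gnp_mean_sum; apply: eq_bigr => K Kk.
rewrite Gnp_mean_sum; apply: eq_bigr => L /andP[Lk _].
by rewrite Gnp_meanZ mean_union.
Qed.

Lemma mean_edge e : e \in edges -> mean (fun G => (e \in G)%:R) = p.
Proof.
move=> eE; rewrite -[RHS]expr1 -(cards1 e) -Gnp_mean_sub ?sub1set //.
by apply: eq_Gnp_mean => G _; rewrite sub1set.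
Qed.

Lemma card_graph (G : {set {set 'I_n}}) : is_graph G ->
  #|G|%:R = \sum_(e in edges) (e \in G)%:R :> R.
Proof.
move=> gG; rewrite -sum1_card natr_sum big_mkcond [RHS]big_mkcond.
apply: eq_bigr => e _; case: (boolP (e \in G)) => eG; last by rewrite if_same.
by rewrite (subsetP gG).
Qed.

Lemma mean_edge_deviation : mean edge_deviation <= p * N0%:R.
Proof.
have -> : mean edge_deviation =
    mean (fun G => \sum_(e in edges) \sum_(f in edges) ([set e; f] \subset G)%:R +
      (- (2 * (p * N0%:R)) * (\sum_(e in edges) (e \in G)%:R) + (p * N0%:R) ^+ 2)).
  apply: eq_Gnp_mean => G gG; rewrite /edge_deviation (card_graph gG).
  set x := \sum_(_ in _) _.
  have -> : \sum_(e in edges) \sum_(f in edges) ([set e; f] \subset G)%:R = x * x.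
    rewrite /x mulr_suml; apply: eq_bigr => e _; rewrite mulr_sumr.
    by apply: eq_bigr => f _; rewrite subUset !sub1set -natrM mulnb.
  by ring.
rewrite !Gnp_meanD Gnp_meanZ Gnp_mean_cst !Gnp_mean_sum.
rewrite [X in _ * X](eq_bigr (fun=> p)); last by move=> e eE; rewrite mean_edge.
rewrite sumr_const card_edges -[p *+ _]mulr_natr.
have : \sum_(e in edges) mean (fun G => \sum_(f in edges) ([set e; f] \subset G)%:R)
    <= \sum_(e in edges) (p + N0%:R * p ^+ 2).
  apply: ler_sum => e eE; rewrite Gnp_mean_sum (bigD1 e) //=; apply: lerD.
    rewrite setUid Gnp_mean_sub ?sub1set // cards1 expr1 //.
  apply: (@le_trans _ _ (\sum_(f in edges | f != e) p ^+ 2)).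
    apply: ler_sum => f /andP[fE fe]; rewrite Gnp_mean_sub ?subUset ?sub1set ?eE //.
    by rewrite cards2 eq_sym fe.
  rewrite big_mkcondr -card_edges mulr_natl -sumr_const; apply: ler_sum => f _.
  by case: ifP => // _; rewrite exprn_ge0 // ltW.
rewrite sumr_const card_edges -[_ *+ N0]mulr_natr; lra.
Qed.

Lemma sum_clique_degree (G : {set {set 'I_n}}) :
  \sum_(e in edges) clique_degree G e =
  \sum_(K in ksets) r%:R * (pairs_of K \subset G)%:R.
Proof.
rewrite exchange_big /=; apply: eq_bigr => K Kk.
rewrite -(card_kpairs Kk) -sum1_card natr_sum mulr_suml.
rewrite big_mkcond [RHS]big_mkcond; apply: eq_bigr => e _.
case: (boolP (e \in pairs_of K)) => eK /=; last by rewrite if_same.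
by rewrite (subsetP (pairs_of_edges K)) // mul1r.
Qed.

Lemma sum_clique_degree2 (G : {set {set 'I_n}}) :
  \sum_(e in edges) clique_degree G e ^+ 2 =
  \sum_(K in ksets) \sum_(L in ksets)
    'C(#|K :&: L|, 2)%:R * (pairs_of K :|: pairs_of L \subset G)%:R.
Proof.
under eq_bigr do rewrite expr2 mulr_suml.
rewrite exchange_big /=; apply: eq_bigr => K _.
under eq_bigr do rewrite mulr_sumr.
rewrite exchange_big /=; apply: eq_bigr => L _.
rewrite -card_pairs_of -pairs_ofI -sum1_card natr_sum mulr_suml.
rewrite big_mkcond [RHS]big_mkcond; apply: eq_bigr => e _.
rewrite in_setI subUset -natrM mulnb.
case: (boolP (e \in pairs_of K)) => eK /=; last by rewrite if_same.
rewrite (subsetP (pairs_of_edges K)) //.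
by case: (e \in pairs_of L); rewrite /= ?andbF ?mul1r // andbT.
Qed.

Lemma N0_gt0 : 0 < N0%:R :> R.
Proof. by rewrite ltr0n bin_gt0. Qed.

Lemma bin_pairs : (N0 * 'C(n - 2, k - 2) = 'C(n, k) * r)%N.
Proof.
move: n2 k2; case: n => [//|[//|m]]; case: k => [//|[//|l]] _ _.
rewrite !subSS !subn0.
apply/eqP; rewrite -(eqn_pmul2l (isT : 0 < 2)%N); apply/eqP.
have -> : (2 * ('C(m.+2, 2) * 'C(m, l)) = m.+2 * (m.+1 * 'C(m, l)))%N.
  by rewrite mulnA -(mul_bin_diag m.+2 1) bin1 mulnA.
have -> : (2 * ('C(m.+2, l.+2) * 'C(l.+2, 2)) = l.+2 * 'C(m.+2, l.+2) * l.+1)%N.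
  by rewrite mulnCA -(mul_bin_diag l.+2 1) bin1 /= mulnCA mulnA.
have h1 := mul_bin_diag m.+1 l; have h2 := mul_bin_diag m.+2 l.+1.
by rewrite /= in h1 h2; rewrite h1 -h2 -mulnA [(_ * l.+1)%N]mulnC.
Qed.

(** Counting common pairs edge by edge turns the left side into a sum over [e] of the squared number
    of [k]-sets above [e], each number being at most ['C(n - 2, k - 2)]. *)
Lemma sum_inter_pairs :
  \sum_(K in ksets) \sum_(L in ksets) 'C(#|K :&: L|, 2)%:R <=
  ('C(n, k) * r)%:R ^+ 2 / N0%:R :> R.
Proof.
apply: (@le_trans _ _ (\sum_(e in edges)
    #|[set L : {set 'I_n} | (#|L| == k) && (e \subset L)]|%:R ^+ 2)).
  rewrite le_eqVlt; apply/orP; left; apply/eqP.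
  have E e : e \in edges ->
      #|[set L : {set 'I_n} | (#|L| == k) && (e \subset L)]|%:R =
      \sum_(L in ksets) (e \in pairs_of L)%:R :> R.
    rewrite inE => /andP[_ e2].
    rewrite -sum1_card natr_sum big_mkcond [RHS]big_mkcond.
    apply: eq_bigr => L _; rewrite !inE e2 andbT.
    by case: (#|L| == k); case: (e \subset L).
  rewrite [RHS](eq_bigr (fun e => (\sum_(L in ksets) (e \in pairs_of L)%:R) ^+ 2));
    last by move=> e eE; rewrite E.
  under [RHS]eq_bigr do rewrite expr2 mulr_suml.
  rewrite [RHS]exchange_big /=; apply: eq_bigr => K _.
  under [RHS]eq_bigr do rewrite mulr_sumr.
  rewrite [RHS]exchange_big /=; apply: eq_bigr => L _.
  rewrite -card_pairs_of -pairs_ofI -sum1_card natr_sum.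
  rewrite big_mkcond [RHS]big_mkcond; apply: eq_bigr => e _.
  rewrite in_setI -natrM mulnb.
  case: (boolP (e \in pairs_of K)) => eK /=; last by rewrite if_same.
  rewrite (subsetP (pairs_of_edges K)) //.
  by case: (e \in pairs_of L).
apply: (@le_trans _ _ (\sum_(e in edges) 'C(n - 2, k - 2)%:R ^+ 2)).
  apply: ler_sum => e; rewrite inE => /andP[_ /eqP e2].
  by rewrite lerXn2r ?nnegrE // ler_nat -e2 card_over_le.
rewrite sumr_const card_edges -bin_pairs natrM exprMn ler_pdivlMr ?N0_gt0 //.
by rewrite -[_ *+ N0]mulr_natr mulrAC -mulrA -expr2 mulrC.
Qed.

(** Expand the square. Two [k]-sets sharing one edge are both cliques with probability
    [p ^ (2 * r - 1)]. Charging this probability to every common edge of every pair gives at most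
    [(r * mu) ^ 2 / (p * N0)], which the other two terms of the square cancel exactly. Only pairs
    with three or more common vertices remain. *)
Lemma mean_degree_deviation : mean degree_deviation <= overlap_mean.
Proof.
have N00 := N0_gt0.
have -> : mean degree_deviation =
    mean (fun G => \sum_(e in edges) clique_degree G e ^+ 2 +
      (- (2 * D0) * (\sum_(e in edges) clique_degree G e) +
       D0 ^+ 2 * \sum_(e in edges) (e \in G)%:R)).
  apply: eq_Gnp_mean => G gG; rewrite /degree_deviation !mulr_sumr -!big_split /=.
  apply: eq_bigr => e eE.
  have -> : clique_degree G e = clique_degree G e * (e \in G)%:R.
    rewrite /clique_degree mulr_suml; apply: eq_bigr => K _.
    rewrite -natrM mulnb; case: (boolP (e \in G)) => eG; rewrite ?andbT // andbF.
    case: (boolP (e \in pairs_of K)) => //= eK.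
    by rewrite (_ : _ \subset _ = false) //; apply: contraNF eG => /subsetP ->.
  by case: (e \in G); rewrite ?mulr1 ?mulr0; ring.
rewrite !Gnp_meanD !Gnp_meanZ.
have -> : mean (fun G => \sum_(e in edges) (e \in G)%:R) = p * N0%:R.
  rewrite Gnp_mean_sum (eq_bigr (fun=> p)); last by move=> e eE; rewrite mean_edge.
  by rewrite sumr_const card_edges -[p *+ _]mulr_natr.
have -> : mean (fun G => \sum_(e in edges) clique_degree G e) = r%:R * mu.
  rewrite (@eq_Gnp_mean R n p _ (fun G => \sum_(K in ksets) r%:R * (pairs_of K \subset G)%:R));
    last by move=> G _; exact: sum_clique_degree.
  rewrite Gnp_mean_sum (eq_bigr (fun=> r%:R * p ^+ r)); last first.
    by move=> K Kk; rewrite Gnp_meanZ Gnp_mean_sub ?pairs_of_edges // card_kpairs.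
  by rewrite sumr_const card_ksets -[_ *+ _]mulr_natl /expected_kcliques; ring.
have : mean (fun G => \sum_(e in edges) clique_degree G e ^+ 2) <=
    (r%:R * mu) ^+ 2 / (p * N0%:R) + overlap_mean.
  rewrite (@eq_Gnp_mean R n p _ (fun G => \sum_(K in ksets) \sum_(L in ksets)
    'C(#|K :&: L|, 2)%:R * (pairs_of K :|: pairs_of L \subset G)%:R)); last first.
    by move=> G _; exact: sum_clique_degree2.
  apply: (@le_trans _ _ (\sum_(K in ksets) (\sum_(L in ksets)
    p ^+ (2 * r - 1) * 'C(#|K :&: L|, 2)%:R +
    \sum_(L in ksets | (2 < #|K :&: L|)%N)
    'C(#|K :&: L|, 2)%:R ^+ 2 * p ^+ (2 * r - 'C(#|K :&: L|, 2))))).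
    rewrite Gnp_mean_sum; apply: ler_sum => K Kk; rewrite Gnp_mean_sum.
    rewrite [X in _ + X]big_mkcondr -big_split /=; apply: ler_sum => L Lk.
    rewrite Gnp_meanZ mean_union //.
    case: ifP => j2.
      rewrite -[leLHS]add0r; apply: lerD; first by rewrite mulr_ge0 // exprn_ge0 // ltW.
      rewrite ler_wpM2r ?exprn_ge0 ?(ltW p0) // expr2 ler_peMl // ler1n bin_gt0.
      by rewrite ltnW.
    rewrite addr0; move/negbT: j2; rewrite -leqNgt => j2.
    move: j2; rewrite leq_eqVlt => /orP[/eqP ->|j1].
      by rewrite binn mulrC.
    by rewrite bin_small // mul0r mulr0.
  rewrite big_split /= lerD2r.
  under eq_bigr do rewrite -mulr_sumr.
  rewrite -mulr_sumr.
  have r0 : (0 < r)%N by rewrite bin_gt0.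
  apply: (le_trans (ler_wpM2l _ sum_inter_pairs)); first by rewrite exprn_ge0 // ltW.
  rewrite /expected_kcliques natrM.
  have -> : p ^+ r = p * p ^+ r.-1 by rewrite -exprS prednK.
  have -> : p ^+ (2 * r - 1) = p * (p ^+ r.-1) ^+ 2.
    rewrite -exprM -exprS; congr (_ ^+ _).
    by rewrite -{1}(prednK r0) mulnC mulSn addSn subn1.
  rewrite le_eqVlt; apply/orP; left; apply/eqP.
  by field; rewrite !gt_eqF.
have -> : D0 ^+ 2 * (p * N0%:R) = (r%:R * mu) ^+ 2 / (p * N0%:R).
  by rewrite /mean_degree; field; rewrite !gt_eqF.
have -> : - (2 * D0) * (r%:R * mu) = - 2 * ((r%:R * mu) ^+ 2 / (p * N0%:R)).
  by rewrite /mean_degree; field; rewrite !gt_eqF.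
by lra.
Qed.

(** Group the sets [L] by [j = #|K :&: L|], bound the weight by [r ^ 2], and split
    [p ^ (2 * r - 'C(j, 2))] as [p ^ r * p ^ (r - 'C(j, 2))]. *)
Lemma overlap_mean_le (eps : R) : (k <= n)%N -> 0 <= eps ->
  (forall j, (3 <= j <= k)%N ->
     ('C(k, j) * 'C(n - k, k - j))%:R * p ^+ (r - 'C(j, 2)) <= eps * mu) ->
  overlap_mean <= mu ^+ 2 * eps * k%:R * r%:R ^+ 2.
Proof.
move=> kn eps0 Hj.
have mu0 : 0 <= mu by rewrite mulr_ge0 // exprn_ge0 // ltW.
apply: (@le_trans _ _ (\sum_(K in ksets) p ^+ r * r%:R ^+ 2 * (k%:R * (eps * mu)))).
  apply: ler_sum => K Kk; have /eqP cK : #|K| == k by rewrite inE in Kk.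
  rewrite (partition_big (fun L : {set 'I_n} => inord #|K :&: L| : 'I_k.+1)
    (fun j : 'I_k.+1 => (2 < j)%N)) /=; last first.
    move=> L /andP[_ h]; rewrite inordK // ltnS -cK.
    by rewrite subset_leq_card // subsetIl.
  apply: (@le_trans _ _ (\sum_(j < k.+1 | (2 < j)%N) p ^+ r * r%:R ^+ 2 * (eps * mu))).
    apply: ler_sum => j j2.
    have jk : (j <= k)%N by rewrite -ltnS ltn_ord.
    have jr : ('C(j, 2) <= r)%N by exact: leq_bin2l.
    apply: (@le_trans _ _ (\sum_(L in [set L : {set 'I_n} | (#|L| == k) && (#|L :&: K| == j)])
       r%:R ^+ 2 * (p ^+ r * p ^+ (r - 'C(j, 2))))).
      rewrite big_mkcond [leRHS]big_mkcond; apply: ler_sum => L _.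
      case: ifP => [/andP[/andP[Lk L2] /eqP Lj]|_]; last first.
        by case: ifP => // _; rewrite !mulr_ge0 // exprn_ge0 // ltW.
      have cj : #|K :&: L| = j.
        by rewrite -Lj inordK // ltnS -cK subset_leq_card // subsetIl.
      rewrite !inE in Lk; rewrite !inE Lk [L :&: K]setIC cj eqxx /=.
      rewrite ler_pM ?exprn_ge0 ?(ltW p0) //.
        by rewrite lerXn2r ?nnegrE // ler_nat.
      by rewrite -exprD addnBA // mul2n addnn.
    rewrite sumr_const -[leLHS]mulr_natl.
    apply: (@le_trans _ _ (('C(k, j) * 'C(n - k, k - j))%:R *
        (r%:R ^+ 2 * (p ^+ r * p ^+ (r - 'C(j, 2)))))).
      rewrite ler_wpM2r ?mulr_ge0 ?exprn_ge0 ?(ltW p0) //.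
      by rewrite ler_nat; have := card_inter_le k j K; rewrite cK.
    have := Hj j; rewrite j2 jk => /(_ isT) h.
    have -> : ('C(k, j) * 'C(n - k, k - j))%:R * (r%:R ^+ 2 * (p ^+ r * p ^+ (r - 'C(j, 2))))
      = p ^+ r * r%:R ^+ 2 * (('C(k, j) * 'C(n - k, k - j))%:R * p ^+ (r - 'C(j, 2))).
      by ring.
    by rewrite ler_wpM2l // mulr_ge0 ?exprn_ge0 // ltW.
  rewrite -mulr_sumr ler_wpM2l ?mulr_ge0 ?exprn_ge0 ?(ltW p0) //.
  have : 0 <= eps * mu by rewrite mulr_ge0.
  move: (eps * mu) => m m0.
  (* The index 0 is excluded by [2 < j], so the [k + 1] indices contribute at most [k] terms. *)
  rewrite big_mkcond big_ord_recl /= add0r -[in leRHS](card_ord k) mulr_natl -sumr_const.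
  by apply: ler_sum => j _; case: ifP.
rewrite sumr_const card_ksets -[leLHS]mulr_natl le_eqVlt; apply/orP; left; apply/eqP.
by rewrite /expected_kcliques; ring.
Qed.

End CliqueMoments.

(** * Pruning the clique hypergraph *)

Section Pruning.
Variables (R : realType) (n k : nat) (p : R) (G : {set {set 'I_n}}).
Variables (kap eta C : R).
Hypothesis kap01 : 0 < kap <= 1.
Hypothesis eta0 : 0 < eta.
Hypothesis C0 : 0 < C.
Hypothesis gG : is_graph G.

Local Notation edges := (pairs_of [set: 'I_n]).
Local Notation r := 'C(k, 2).
Local Notation ksets := (ksets n k).
Local Notation deg := (clique_degree R k G).
Local Notation D0 := (mean_degree n k p).
Local Notation dev := (degree_deviation k p G).

Hypothesis D0_gt0 : 0 < D0.

Definition cliques : {set {set 'I_n}} := [set K in ksets | pairs_of K \subset G].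

(** Degrees here, and codegrees in [light_pairs], are measured among all cliques of [G]. Pruning
    only lowers them, so one round is enough. *)
Definition light_edges (K : {set 'I_n}) : bool :=
  [forall e in pairs_of K, deg e <= (1 + kap) * D0].

Definition light_pairs (K : {set 'I_n}) : bool :=
  [forall e in pairs_of K, forall f in pairs_of K,
     (e != f) ==> ((codegree (@pairs_of n) cliques e f)%:R <= C)].

Definition light_cliques : {set {set 'I_n}} :=
  [set K in cliques | light_edges K && light_pairs K].

Lemma deg_cliques e : deg e = #|[set K in cliques | e \in pairs_of K]|%:R.
Proof.
rewrite -sum1_card natr_sum /clique_degree big_mkcond [RHS]big_mkcond.
apply: eq_bigr => K _; rewrite !inE.
by case: (#|K| == k); case: (_ \subset G); case: (e \subset K); case: (#|e| == 2%N).
Qed.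

Lemma light_cliques_degree e :
  (degree (@pairs_of n) light_cliques G e)%:R <= (1 + kap) * D0.
Proof.
case: (set_0Vmem [set K in alive (@pairs_of n) light_cliques G | e \in pairs_of K])
    => [E|[K]].
  case/andP: kap01 => k0 _.
  by rewrite /degree E cards0 mulr_ge0 ?ltW // addr_gt0.
rewrite 2!inE => /andP[/andP[KL _] eK].
move: KL; rewrite inE => /andP[_ /andP[/forall_inP h _]].
apply: le_trans (h _ eK); rewrite deg_cliques ler_nat /degree subset_leq_card //.
by apply/subsetP => L /setIdP[/setIdP[/setIdP[Lc _] _] eL]; rewrite inE Lc.
Qed.

Lemma light_cliques_codegree e f : e != f ->
  (codegree (@pairs_of n) light_cliques e f)%:R <= C.
Proof.
move=> ef.
case: (set_0Vmem [set K in light_cliques | (e \in pairs_of K) && (f \in pairs_of K)])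
    => [E|[K]].
  by rewrite /codegree E cards0 ltW.
rewrite inE => /andP[KL /andP[eK fK]].
move: KL; rewrite inE => /andP[_ /andP[_ /forall_inP /(_ _ eK) /forall_inP /(_ _ fK)]].
rewrite ef /= => h; apply: le_trans h; rewrite ler_nat /codegree subset_leq_card //.
by apply/subsetP => L /setIdP[/setIdP[Lc _] h]; rewrite inE Lc.
Qed.

(** If [x = deg e] exceeds [(1 + kap) * D0], then [kap * D0 <= x - D0] and
    [kap * x <= 2 * (x - D0)]. So all [x] cliques through [e] are charged to
    [2 * (x - D0) ^ 2 / (kap ^ 2 * D0)]. *)
Lemma heavy_edges_card :
  #|[set K in cliques | ~~ light_edges K]|%:R <= 2 * dev / (kap ^+ 2 * D0).
Proof.
case/andP: kap01 => k0 k1.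
apply: (@le_trans _ _ (\sum_(K in cliques) \sum_(e in pairs_of K)
    (~~ (deg e <= (1 + kap) * D0))%:R)).
  rewrite -sum1_card natr_sum big_mkcond [leRHS]big_mkcond; apply: ler_sum => K _.
  rewrite inE; case: (K \in cliques) => //=.
  case: ifPn => [/forall_inPn[e eK he]|_]; last by apply: sumr_ge0.
  by rewrite (bigD1 e) //= he lerDl sumr_ge0.
have -> : \sum_(K in cliques) \sum_(e in pairs_of K) (~~ (deg e <= (1 + kap) * D0))%:R =
    \sum_(e in edges) deg e * (~~ (deg e <= (1 + kap) * D0))%:R :> R.
  under [RHS]eq_bigr do rewrite [X in X * _]deg_cliques -sum1_card natr_sum mulr_suml.
  rewrite (exchange_big_dep (mem edges)) /=; last first.
    by move=> K e _ eK; rewrite (subsetP (pairs_of_edges K)).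
  apply: eq_bigr => e eE; apply: eq_big => [K|K _]; last by rewrite mul1r.
  by rewrite [RHS]in_set.
rewrite /degree_deviation mulrAC mulr_sumr; apply: ler_sum => e eE.
case: (boolP (deg e <= _)) => he /=.
  by rewrite mulr0 mulr_ge0 ?sqr_ge0 // divr_ge0 // mulr_ge0 ?exprn_ge0 ?ltW.
move: he; rewrite mulr1 -ltNge => he.
have -> : e \in G.
  apply: contraT => eG; suff d0 : deg e = 0.
    have : 0 < (1 + kap) * D0 by rewrite mulr_gt0 // addr_gt0.
    by move: he; rewrite d0 => h1 h2; have := lt_trans h1 h2; rewrite ltxx.
  rewrite /clique_degree big1 // => K _; case: (boolP (e \in pairs_of K)) => //= eK.
  by case: (boolP (pairs_of K \subset G)) => // /subsetP /(_ _ eK); rewrite (negbTE eG).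
have kD2 : 0 < kap ^+ 2 * D0 by apply: mulr_gt0 => //; exact: exprn_gt0.
rewrite mulr1 mulrAC ler_pdivlMr //.
set x := deg e; have hx : kap * D0 < x - D0 by rewrite -/x in he; lra.
have kD : 0 < kap * D0 by rewrite mulr_gt0.
have h1 : kap * x <= 2 * (x - D0).
  have : kap * (x - D0) <= 1 * (x - D0) by rewrite ler_wpM2r //; lra.
  by lra.
have h2 : (kap * x) * (kap * D0) <= 2 * (x - D0) * (x - D0).
  apply: ler_pM => //; try exact: ltW.
  by apply: mulr_ge0; first exact: ltW; have := D0_gt0; lra.
by move: h2; rewrite !expr2; lra.
Qed.

(** Each clique counted has two edges of codegree above [C]. Summing codegrees over all cliques and
    their pairs of edges counts, for cliques [K] and [L], the ordered pairs of distinct common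
    edges; there are at most ['C(#|K :&: L|, 2) ^ 2], and none unless three vertices are shared. *)
Lemma heavy_pairs_card :
  #|[set K in cliques | ~~ light_pairs K]|%:R <= overlap R k G / C.
Proof.
rewrite ler_pdivlMr //.
pose cod e f : R := (codegree (@pairs_of n) cliques e f)%:R.
apply: (@le_trans _ _ (\sum_(K in cliques) \sum_(e in pairs_of K)
    \sum_(f in pairs_of K | e != f) cod e f)).
  rewrite -sum1_card natr_sum big_mkcond mulr_suml [leRHS]big_mkcond.
  apply: ler_sum => K _; rewrite inE; case: (K \in cliques) => /=; last by rewrite mul0r.
  have s0 : 0 <= \sum_(e in pairs_of K) \sum_(f in pairs_of K | e != f) cod e f.
    by apply: sumr_ge0 => e _; apply: sumr_ge0.
  case: ifPn => [/forall_inPn[e eK /forall_inPn[f fK]]|_]; last by rewrite mul0r.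
  rewrite negb_imply -ltNge mul1r => /andP[ef /ltW Ccod].
  apply: le_trans Ccod _; rewrite (bigD1 e) //= (bigD1 f) /= ?fK // -addrA lerDl.
  by apply: addr_ge0; apply: sumr_ge0 => // *; apply: sumr_ge0.
have -> : \sum_(K in cliques) \sum_(e in pairs_of K) \sum_(f in pairs_of K | e != f) cod e f =
    \sum_(K in cliques) \sum_(L in cliques)
      \sum_(e in pairs_of K) \sum_(f in pairs_of K | e != f)
        ((e \in pairs_of L) && (f \in pairs_of L))%:R :> R.
  apply: eq_bigr => K _; rewrite [RHS]exchange_big /=; apply: eq_bigr => e _.
  by rewrite [RHS]exchange_big /=; apply: eq_bigr => f _; rewrite /cod codegree_sum.
have sub_cl (F : {set 'I_n} -> R) : (forall K, 0 <= F K) ->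
    \sum_(K in cliques) F K = \sum_(K in ksets) F K * (pairs_of K \subset G)%:R.
  move=> F0; rewrite big_mkcond [RHS]big_mkcond; apply: eq_bigr => K _.
  by rewrite !inE; case: (#|K| == k); case: (_ \subset G); rewrite /= ?mulr1 ?mulr0.
rewrite sub_cl; last by move=> K; do 3!apply: sumr_ge0 => ? _.
rewrite /overlap; apply: ler_sum => K _.
rewrite sub_cl; last by move=> L; do 2!apply: sumr_ge0 => ? _.
rewrite [leRHS]big_mkcondr mulr_suml; apply: ler_sum => L _.
rewrite subUset -mulrA -natrM mulnb andbC.
case: (boolP ((pairs_of K \subset G) && (pairs_of L \subset G))) => _; last first.
  by rewrite !mulr0; case: ifP.
rewrite !mulr1.
have -> : \sum_(e in pairs_of K) \sum_(f in pairs_of K | e != f)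
      ((e \in pairs_of L) && (f \in pairs_of L))%:R =
    \sum_(e in pairs_of (K :&: L)) \sum_(f in pairs_of (K :&: L) | e != f) 1 :> R.
  rewrite -pairs_ofI big_mkcond [RHS]big_mkcond; apply: eq_bigr => e _.
  rewrite in_setI; case: (e \in pairs_of K) => //=; case: (e \in pairs_of L) => /=; last first.
    by rewrite big1.
  rewrite big_mkcond [RHS]big_mkcond; apply: eq_bigr => f _.
  rewrite in_setI; case: (f \in pairs_of K) => //=; case: (f \in pairs_of L) => /=;
  by case: (e != f).
rewrite -card_pairs_of; set A := pairs_of (K :&: L).
case: ifPn => [_|]; last first.
  rewrite -leqNgt => h.
  have A1 : (#|A| <= 1)%N.
    by rewrite card_pairs_of; apply: leq_trans (leq_bin2l _ h) _.
  rewrite big1 // => e eA; rewrite big1 // => f /andP[fA ef].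
  by move: A1 => /card_le1_eqP /(_ _ _ eA fA) E; rewrite E eqxx in ef.
apply: (@le_trans _ _ (\sum_(e in A) #|A|%:R)); last first.
  by rewrite sumr_const -[leLHS]mulr_natl expr2.
apply: ler_sum => e _; rewrite -sum1_card natr_sum big_mkcondr.
by apply: ler_sum => f _; case: ifP.
Qed.

(** For [e] in [G], a deficit [D0 - deg e] above [eta * D0] is at most
    [(deg e - D0) ^ 2 / (eta * D0)]. *)
Lemma cliques_card :
  (1 - eta) * D0 * #|G|%:R - dev / (eta * D0) <= r%:R * #|cliques|%:R.
Proof.
have -> : r%:R * #|cliques|%:R = \sum_(e in edges) deg e.
  rewrite sum_clique_degree -sum1_card natr_sum mulr_sumr.
  rewrite big_mkcond [RHS]big_mkcond; apply: eq_bigr => K _; rewrite !inE.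
  by case: (#|K| == k); case: (_ \subset G); rewrite /= ?mulr1 ?mulr0.
rewrite (card_graph _ gG) mulr_sumr /degree_deviation mulr_suml -sumrB.
apply: ler_sum => e _; set x := deg e.
have x0 : 0 <= x by apply: sumr_ge0.
have eD : 0 < eta * D0 by rewrite mulr_gt0.
have q0 y : 0 <= y ^+ 2 / (eta * D0) by rewrite divr_ge0 ?sqr_ge0 // ltW.
case: (e \in G); rewrite ?mulr1 ?mulr0 ?sub0r; last by have := q0 (x - 0); rewrite subr0; lra.
case: (leP (D0 - x) (eta * D0)) => h; first by have := q0 (x - D0); lra.
have : D0 - x <= (x - D0) ^+ 2 / (eta * D0).
  by rewrite ler_pdivlMr //; nra.
have : 0 < eta * D0 by [].
by lra.
Qed.

Lemma light_cliques_card :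
  (1 - eta) * D0 * #|G|%:R - dev / (eta * D0) -
  r%:R * (2 * dev / (kap ^+ 2 * D0)) - r%:R * (overlap R k G / C) <=
  r%:R * #|light_cliques|%:R.
Proof.
have : (#|cliques| <= #|light_cliques| + #|[set K in cliques | ~~ light_edges K]| +
    #|[set K in cliques | ~~ light_pairs K]|)%N.
  apply: leq_trans (_ : #|light_cliques :|: [set K in cliques | ~~ light_edges K]
     :|: [set K in cliques | ~~ light_pairs K]| <= _)%N.
    apply/subset_leq_card/subsetP => K Kc.
    rewrite !inE in Kc; rewrite !inE Kc /=.
    by case: (light_edges K); case: (light_pairs K).
  apply: leq_trans (leq_card_setU _ _) _; rewrite leq_add2r.
  exact: leq_card_setU.
rewrite -(ler_nat R) !natrD => h.
have r0 : 0 <= r%:R :> R by [].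
have h1 := ler_wpM2l r0 h.
have h2 := ler_wpM2l r0 heavy_edges_card.
have h3 := ler_wpM2l r0 heavy_pairs_card.
have h4 := cliques_card.
by lra.
Qed.

End Pruning.

(** The main term is at least [(99 / 100) ^ 2 * D0 * W]. Of the losses, that from overlaps keeps
    only one power of [g], since dividing by [D0 / g ^ 5] consumes five of the six. *)
Lemma pruning_loss (R : realType) (D0 W N k r g dev ov : R) :
  0 < D0 -> 0 < W -> 99 / 100 * W <= N -> 1 <= k -> 1 <= r ->
  100 ^+ 2 * (k * r ^+ 3) <= g ->
  dev <= D0 ^+ 2 * W * (k / g ^+ 6) -> ov <= D0 ^+ 2 * W * (k / g ^+ 6) ->
  97 / 100 * (D0 * W) <=
  (1 - 100^-1) * D0 * N - dev / (100^-1 * D0) -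
  r * (2 * dev / ((100 * r)^-1 ^+ 2 * D0)) - r * (ov / (D0 / g ^+ 5)).
Proof.
move=> D00 W0 NW k1 r1 gkr devM ovM.
have r0 : 0 < r by lra.
have k0 : 0 < k by lra.
have kr1 : 1 <= k * r ^+ 3.
  by rewrite -[leLHS]mulr1 ler_pM // -[leLHS](expr1n _ 3) lerXn2r ?nnegrE // ltW.
have gE : 10 ^+ 4 <= g by move: gkr; rewrite -!natrX; lra.
have g0 : 0 < g by move: gE; rewrite -natrX; lra.
have g1 : 1 <= g by move: gE; rewrite -natrX; lra.
pose w := k * r ^+ 3 / g.
have w0 : 0 < w by rewrite !mulr_gt0 ?invr_gt0 ?exprn_gt0.
have w1 : 100 ^+ 2 * w <= 1 by rewrite mulrA ler_pdivrMr // mul1r.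
have rr3 : r <= r ^+ 3 by rewrite -[leLHS]expr1 ler_weXn2l.
have gi : (g ^+ 5)^-1 <= (100 ^+ 2)^-1.
  rewrite lef_pV2 ?posrE ?exprn_gt0 //.
  have : g <= g ^+ 5 by rewrite -[leLHS]expr1 ler_weXn2l.
  by move: gE; rewrite -!natrX; lra.
pose E := D0 * W.
have E0 : 0 < E by rewrite mulr_gt0.
have wg : w / g ^+ 5 <= w / 100 ^+ 2 by rewrite ler_pM2l.
have kr : k <= k * r ^+ 3.
  by rewrite ler_peMr ?(ltW k0) // -[leLHS](expr1n _ 3) lerXn2r ?nnegrE // ltW.
have b1 : dev / (100^-1 * D0) <= 100 * (E * (w / 100 ^+ 2)).
  apply: (@le_trans _ _ (D0 ^+ 2 * W * (k * r ^+ 3 / g ^+ 6) / (100^-1 * D0))).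
    rewrite ler_pM2r ?invr_gt0 ?mulr_gt0 ?invr_gt0 //; apply: le_trans devM _.
    by rewrite ler_pM2l ?mulr_gt0 ?exprn_gt0 // ler_pM2r ?invr_gt0 ?exprn_gt0.
  have -> : D0 ^+ 2 * W * (k * r ^+ 3 / g ^+ 6) / (100^-1 * D0) = 100 * (E * (w / g ^+ 5)).
    by rewrite /w /E; field; rewrite !gt_eqF.
  by rewrite ler_pM2l // ler_pM2l.
have b2 : r * (2 * dev / ((100 * r)^-1 ^+ 2 * D0)) <= 2 * 100 ^+ 2 * (E * (w / 100 ^+ 2)).
  have -> : r * (2 * dev / ((100 * r)^-1 ^+ 2 * D0)) = dev * (2 * 100 ^+ 2 * r ^+ 3 / D0).
    by field; rewrite !gt_eqF.
  apply: (@le_trans _ _ (D0 ^+ 2 * W * (k / g ^+ 6) * (2 * 100 ^+ 2 * r ^+ 3 / D0))).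
    by rewrite ler_pM2r // divr_gt0 // !mulr_gt0 ?exprn_gt0.
  have -> : D0 ^+ 2 * W * (k / g ^+ 6) * (2 * 100 ^+ 2 * r ^+ 3 / D0) =
    2 * 100 ^+ 2 * (E * (w / g ^+ 5)) by rewrite /w /E; field; rewrite !gt_eqF.
  by rewrite ler_pM2l ?mulr_gt0 ?exprn_gt0 // ler_pM2l.
have b3 : r * (ov / (D0 / g ^+ 5)) <= E * w.
  have -> : r * (ov / (D0 / g ^+ 5)) = ov * (r * g ^+ 5 / D0) by field; rewrite !gt_eqF.
  apply: (@le_trans _ _ (D0 ^+ 2 * W * (k / g ^+ 6) * (r * g ^+ 5 / D0))).
    by rewrite ler_pM2r // divr_gt0 // !mulr_gt0 ?exprn_gt0.
  have -> : D0 ^+ 2 * W * (k / g ^+ 6) * (r * g ^+ 5 / D0) = E * (k * r / g).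
    by rewrite /E; field; rewrite !gt_eqF.
  by rewrite ler_pM2l // ler_pM2r ?invr_gt0 // ler_pM2l.
have b4 : (1 - 100^-1) * (99 / 100) * E <= (1 - 100^-1) * D0 * N.
  have := ler_wpM2l (ltW D00) NW; rewrite /E; lra.
have Ew : E * (100 ^+ 2 * w) <= E * 1 by rewrite ler_pM2l.
move: b1 b2 b3 b4 Ew E0; rewrite -/E !expr2; lra.
Qed.

(** * Probability bound for a fixed number of vertices *)

Section FixedN.
Variables (R : realType) (n k : nat) (p g s : R).
Hypothesis p01 : 0 < p < 1.
Hypothesis k3 : (3 <= k)%N.
Hypothesis kn : (k <= n)%N.

Local Notation r := 'C(k, 2).
Local Notation N0 := 'C(n, 2).
Local Notation mu := (expected_kcliques p n k).
Local Notation D0 := (mean_degree n k p).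
Let W : R := p * N0%:R.

Hypothesis gkr : 100 ^+ 2 * (k%:R * r%:R ^+ 3) <= g.
Hypothesis ng : n%:R <= expR g.
Hypothesis gW : g <= W.
Hypothesis s01 : 0 < s <= 1.
Hypothesis sW : 200 * r%:R <= s * W.
Hypothesis sr : expR (2 * s * r%:R) <= g ^+ 2.
Hypothesis overlap_terms : forall j, (3 <= j <= k)%N ->
  ('C(k, j) * 'C(n - k, k - j))%:R * p ^+ (r - 'C(j, 2)) <= (n%:R ^+ 2 * g ^+ 7)^-1 * mu.

(** This is [g] times the bound of [overlap_mean_le], so that each Markov estimate with threshold
    [M] fails with probability at most [1 / g]. *)
Let M : R := mu ^+ 2 * (n%:R ^+ 2 * g ^+ 7)^-1 * k%:R * r%:R ^+ 2 * g.

Let n2 : (2 <= n)%N. Proof. exact: leq_trans (leq_trans _ k3) kn. Qed.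
Let p0 : 0 < p. Proof. by case/andP: p01. Qed.
Let N00 : 0 < N0%:R :> R. Proof. exact: N0_gt0. Qed.
Let W0 : 0 < W. Proof. exact: mulr_gt0. Qed.
Let r3 : 3 <= r%:R :> R.
Proof. by rewrite ler_nat; exact: (leq_bin2l 2 k3). Qed.
Let k3' : 3 <= k%:R :> R. Proof. by rewrite ler_nat. Qed.
Let r0 : 0 < r%:R :> R. Proof. exact: lt_le_trans r3. Qed.
Let k0 : 0 < k%:R :> R. Proof. exact: lt_le_trans k3'. Qed.
Let mu0 : 0 < mu.
Proof. by rewrite mulr_gt0 ?exprn_gt0 // ltr0n bin_gt0. Qed.
Let D00 : 0 < D0.
Proof. by rewrite divr_gt0 // mulr_gt0 // (lt_le_trans _ r3). Qed.
Let r3g : 100 ^+ 2 * r%:R ^+ 3 <= g.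
Proof.
apply: le_trans gkr; rewrite ler_wpM2l ?exprn_ge0 // ler_peMl ?exprn_ge0 //.
by apply: le_trans k3'; rewrite ler1n.
Qed.
Let rr3 : r%:R <= r%:R ^+ 3 :> R.
Proof. by rewrite -[leLHS]expr1 ler_weXn2l // (le_trans _ r3) // ler1n. Qed.
Let g1 : 100 ^+ 2 <= g.
Proof.
apply: le_trans r3g; rewrite ler_peMr ?exprn_ge0 // (le_trans _ rr3) // (le_trans _ r3) //.
by rewrite ler1n.
Qed.
Let g0 : 0 < g. Proof. by have := g1; lra. Qed.
Let n0 : 0 < n%:R :> R. Proof. by rewrite ltr0n (leq_trans _ n2). Qed.

Let N0n : N0%:R <= n%:R ^+ 2 / 2 :> R.
Proof.
rewrite ler_pdivlMr // -natrM mulnC -(mul_bin_diag n 1) bin1 -natrX ler_nat.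
by rewrite expnS expn1 leq_mul2l leq_pred orbT.
Qed.

Let Wn : W <= n%:R ^+ 2 / 2.
Proof.
apply: le_trans N0n; rewrite ler_piMl ?ltW //; by case/andP: p01.
Qed.

Let M_le : M <= D0 ^+ 2 * W * (k%:R / g ^+ 6).
Proof.
have -> : D0 ^+ 2 * W * (k%:R / g ^+ 6) =
    mu ^+ 2 * W^-1 * (k%:R * r%:R ^+ 2 / g ^+ 6).
  by rewrite /mean_degree -/W; field; rewrite !gt_eqF.
have -> : M = mu ^+ 2 * (n%:R ^+ 2)^-1 * (k%:R * r%:R ^+ 2 / g ^+ 6).
  by rewrite /M; field; rewrite !gt_eqF.
rewrite ler_wpM2r ?mulr_ge0 ?invr_ge0 ?exprn_ge0 ?(ltW g0) //.
rewrite ler_wpM2l ?exprn_ge0 ?(ltW mu0) // lef_pV2 ?posrE ?exprn_gt0 //.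
by apply: le_trans Wn _; rewrite ler_pdivrMr // ler_peMr ?exprn_ge0 ?(ltW n0) //; lra.
Qed.

Let M0 : 0 < M.
Proof.
have pos (m : R) : 0 < m ->
    0 < m ^+ 2 * (n%:R ^+ 2 * g ^+ 7)^-1 * k%:R * r%:R ^+ 2 * g.
  by move=> m0; rewrite !mulr_gt0 ?exprn_gt0 ?invr_gt0 ?mulr_gt0 ?exprn_gt0.
exact: pos.
Qed.

Lemma packing_of_typical_graph (G : {set {set 'I_n}}) : is_graph G ->
  degree_deviation k p G <= M -> overlap R k G <= M ->
  edge_deviation p G <= (W / 100) ^+ 2 ->
  has_edge_disjoint_kcliques k (s * W / (2 * r%:R)) G.
Proof.
move=> gG devM ovM edgeM.
have [NW WN] : 99 / 100 * W <= #|G|%:R /\ #|G|%:R <= 101 / 100 * W.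
  move: edgeM; rewrite /edge_deviation -/W; set N : R := #|G|%:R => edgeM.
  have W100 : 0 <= W / 100 by rewrite divr_ge0 // ltW.
  have : `|N - W| <= W / 100.
    by rewrite -(ger0_norm W100) -ler_sqr ?nnegrE // !real_normK ?num_real.
  by rewrite ler_norml => /andP[h1 h2]; have := W0; split; lra.
have Nn : #|G|%:R <= expR (2 * g) :> R.
  apply: (@le_trans _ _ (n%:R ^+ 2)).
    by apply: le_trans WN _; have := Wn; have := W0; lra.
  by rewrite expRM_natl lerXn2r ?nnegrE ?expR_ge0.
pose kap : R := (100 * r%:R)^-1.
have kap0 : 0 < kap by rewrite invr_gt0 mulr_gt0.
have kap1 : kap <= 1 by rewrite invf_le1 ?mulr_gt0 //; have := r3; lra.
have C0 : 0 < D0 / g ^+ 5 by apply: divr_gt0 => //; rewrite exprn_gt0.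
pose H := light_cliques k p G kap (D0 / g ^+ 5).
have Hc K : K \in H -> K \in ksets n k /\ pairs_of K \subset G.
  by move=> /setIdP[/setIdP[]].
have kap01 : 0 < kap <= 1 by rewrite kap0.
have [||||||||||||||F [FH packF Fge]] :=
  @nearly_regular_packing R _ _ (@pairs_of n) G H r D0 g s W _ _ _ _ _ _ _ _ _ _ _ _ _ _.
- by rewrite -(ler_nat R).
- by move=> K /Hc[/card_kpairs].
- by move=> K /Hc[].
- exact: D00.
- by move=> e; exact: light_cliques_degree.
- by move=> e f; exact: light_cliques_codegree.
- apply: le_trans (light_cliques_card (eta := 100^-1) kap01 _ C0 gG D00) => //.
  apply: (@pruning_loss R D0 W _ k%:R r%:R g) => //.
  + by rewrite (le_trans _ k3') // ler1n.
  + by rewrite (le_trans _ r3) // ler1n.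
  + exact: le_trans M_le.
  + exact: le_trans M_le.
- exact: r3g.
- exact: gW.
- exact: Nn.
- by rewrite NW.
- exact: s01.
- exact: sW.
- exact: sr.
apply/existsP; exists F; rewrite Fge andbT; apply/andP; split.
  apply/forall_inP => K KF; have [] := Hc K (subsetP FH _ KF).
  by rewrite inE /is_kclique => -> ->.
apply/forall_inP => K1 K1F; apply/forall_inP => K2 K2F; apply/implyP => K12.
exact: packF.
Qed.

Lemma packing_probability_ge :
  1 - 2 * g^-1 - 100 ^+ 2 * g^-1 <=
  Gnp_prob p (has_edge_disjoint_kcliques k (s * W / (2 * r%:R)) (n := n)).
Proof.
case/andP: p01 => _ p1.
have p01' : 0 < p <= 1 by rewrite p0 ltW.
have p01'' : 0 <= p <= 1 by rewrite !ltW.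
have k2 : (2 <= k)%N by exact: ltnW.
have W100 : 0 < (W / 100) ^+ 2 by rewrite exprn_gt0 // divr_gt0.
apply: le_trans (Gnp_prob_ge_markov p01'' _ _ _ M0 M0 W100 packing_of_typical_graph).
- have ov : overlap_mean n k p <= M / g.
    apply: le_trans (overlap_mean_le p01' kn _ overlap_terms) _.
      by rewrite invr_ge0 mulr_ge0 ?exprn_ge0 ?(ltW g0).
    by rewrite /M mulfK ?gt_eqF.
  have d1 : Gnp_mean p (degree_deviation k p (n := n)) / M <= g^-1.
    rewrite (ler_pdivrMr _ _ M0); apply: le_trans (mean_degree_deviation p01' n2 k2) _.
    by rewrite mulrC.
  have d2 : Gnp_mean p (overlap R k (n := n)) / M <= g^-1.
    by rewrite (ler_pdivrMr _ _ M0) mean_overlap // mulrC.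
  have d3 : Gnp_mean p (edge_deviation p (n := n)) / (W / 100) ^+ 2 <= 100 ^+ 2 * g^-1.
    rewrite (ler_pdivrMr _ _ W100); apply: le_trans (mean_edge_deviation _ _) _ => //.
    rewrite -/W (_ : 100 ^+ 2 * g^-1 * (W / 100) ^+ 2 = W * (W / g)); last first.
      by field; rewrite gt_eqF.
    by rewrite ler_peMr ?(ltW W0) // ler_pdivlMr // mul1r.
  by lra.
- by move=> G; apply: sumr_ge0 => e _; rewrite sqr_ge0.
- by move=> G; do 2!apply: sumr_ge0 => ? _; rewrite mulr_ge0 // sqr_ge0.
- by move=> G; rewrite sqr_ge0.
Qed.

End FixedN.

(** * Overlaps of cliques and asymptotics *)

Lemma bin_le_expn (n k : nat) : ('C(n, k) <= n ^ k)%N.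
Proof.
elim: k n => [|k IH] n; first by rewrite bin0.
apply: leq_trans (_ : k.+1 * 'C(n, k.+1) <= _)%N; first exact: leq_pmull.
rewrite -mul_bin_diag expnS leq_mul2l; apply/orP; right.
apply: leq_trans (IH _) _; case: k {IH} => // k.
by rewrite leq_exp2r // leq_pred.
Qed.

(** The ratio of the two binomials is the product of [(k - i) / (n - i)] over [i < j], and each
    factor is at most [k / n]. *)
Lemma bin_sub_le (n k j : nat) : (j <= k)%N -> (k <= n)%N ->
  (n ^ j * 'C(n - j, k - j) <= k ^ j * 'C(n, k))%N.
Proof.
elim: j => [|j IH] jk kn; first by rewrite !subn0.
have nj0 : (0 < n - j)%N by rewrite subn_gt0 (leq_trans jk).
have := IH (ltnW jk) kn; rewrite !expnS -!mulnA => {}IH.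
have E := mul_bin_diag (n - j) (k - j.+1).
rewrite -subnS -subSn // subSS in E.
rewrite -(leq_pmul2l nj0).
apply: leq_trans (_ : n ^ j * (k * (n - j)) * 'C(n - j, k - j) <= _)%N; last first.
  apply: leq_trans (_ : (n - j) * k * (n ^ j * 'C(n - j, k - j)) <= _)%N.
    by rewrite [(k * _)%N]mulnC -!mulnA leq_eqVlt; apply/orP; left; apply/eqP; ring.
  by rewrite -mulnA !leq_mul2l IH !orbT.
have -> : ((n - j) * (n * (n ^ j * 'C(n - j.+1, k - j.+1))) =
    n ^ j * n * ((n - j) * 'C(n - j.+1, k - j.+1)))%N by ring.
rewrite E -!mulnA leq_mul2l mulnA; apply/orP; right.
rewrite mulnA leq_mul2r; apply/orP; right.
by rewrite !mulnBr [(k * n)%N]mulnC leq_sub2l // leq_mul2r kn orbT.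
Qed.

(** Each of the [k - j] additional vertices forms at least [j] new pairs. *)
Lemma bin2_gap (j k : nat) : (j <= k)%N -> ('C(j, 2) + (k - j) * j.-1 <= 'C(k, 2))%N.
Proof.
move=> /subnK <-; rewrite addnK; elim: (k - j)%N => [|m IH]; first by rewrite addn0.
rewrite addSn binS bin1 mulSn addnCA addnC leq_add //.
by rewrite (leq_trans (leq_pred j)) // leq_addl.
Qed.

Lemma natr_bin2 (R : realType) (m : nat) : 'C(m, 2)%:R = m%:R * (m%:R - 1) / 2 :> R.
Proof.
case: m => [|m]; first by rewrite bin0n mul0r mul0r.
have := mul_bin_diag m.+1 1; rewrite bin1 /= => /(congr1 (fun x => x%:R : R)).
rewrite !natrM => h; apply: (mulfI (_ : 2 != 0)); first by rewrite pnatr_eq0.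
by rewrite -h -natr1; field.
Qed.

(* With [n = expR l], [p = expR (- L)] and [k = expR kap], this says that
   [(k ^+ 2 / n) ^+ j * p ^- 'C(j, 2)] is at most [n] to the power
   [- (2 + 7 * a / 40)]. *)
Lemma small_overlap_exponent (R : realType) (l L kap j a : R) :
  0 <= l -> 0 <= L -> L <= l / 1000 -> kap <= l / 280 -> 3 <= j -> a <= 1 ->
  (j - 1) * L <= 19 / 10 * l ->
  2 * j * kap + 2 * l + 7 / 40 * (a * l) + j * (j - 1) / 2 * L <= j * l.
Proof.
move=> l0 L0 Ll kl j3 a1 jL.
have al : a * l <= 1 * l by rewrite ler_wpM2r.
have j0 : 0 <= j by lra.
have kj : j * kap <= j * (l / 280) by rewrite ler_wpM2l.
suff : 87 / 40 * l <= j * (l - l / 140 - (j - 1) * L / 2) by lra.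
(* Up to 100 the edge term is below [l / 10], and [j >= 3] suffices. Beyond,
   [(j - 1) * L <= 19 / 10 * l] leaves only about [l / 20] in the parentheses, which the factor 100
   compensates. *)
have [j100|j100] := leP j 100.
  have h : (j - 1) * L <= 99 * (l / 1000) by rewrite ler_pM //; lra.
  apply: (@le_trans _ _ (3 * (l - l / 140 - (j - 1) * L / 2))); first by lra.
  by rewrite ler_wpM2r //; lra.
apply: (@le_trans _ _ (100 * (l - l / 140 - (j - 1) * L / 2))); first by lra.
by rewrite ler_wpM2r //; lra.
Qed.

Section OverlapTerms.
Variables (R : realType) (n k : nat) (p l L kap : R).
Hypothesis n_exp : n%:R = expR l.
Hypothesis k_exp : k%:R = expR kap.
Hypothesis p_exp : p = expR (- L).
Hypothesis L0 : 0 <= L.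
Hypothesis kn : (k <= n)%N.

Let p0 : 0 < p. Proof. by rewrite p_exp expR_gt0. Qed.
Let p1 : p <= 1. Proof. by rewrite p_exp -expR0 ler_expR oppr_le0. Qed.

(** One factor [k ^ j] bounds ['C(k, j)]; the factor [(k / n) ^ j] comes from [bin_sub_le], and
    [p ^- 'C(j, 2)] from the shared edges. *)
Lemma overlap_term_small j : (j <= k)%N ->
  ('C(k, j) * 'C(n - k, k - j))%:R * p ^+ ('C(k, 2) - 'C(j, 2)) <=
  expR (2 * j%:R * kap - j%:R * l + 'C(j, 2)%:R * L) * expected_kcliques p n k.
Proof.
move=> jk.
have jr : ('C(j, 2) <= 'C(k, 2))%N by exact: leq_bin2l.
have nat_le : (n ^ j * ('C(k, j) * 'C(n - k, k - j)) <= k ^ j * k ^ j * 'C(n, k))%N.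
  apply: leq_trans (_ : k ^ j * (n ^ j * 'C(n - j, k - j)) <= _)%N; last first.
    by rewrite -mulnA leq_mul2l bin_sub_le // orbT.
  rewrite mulnCA leq_mul ?bin_le_expn // leq_mul2l; apply/orP; right.
  by apply: leq_bin2l; rewrite leq_sub2l.
have e0 := expR_gt0 (j%:R * l).
rewrite /expected_kcliques -(ler_pM2l e0).
have -> : expR (j%:R * l) = (n ^ j)%:R by rewrite expRM_natl -n_exp natrX.
have -> : p ^+ 'C(k, 2) = p ^+ ('C(k, 2) - 'C(j, 2)) * p ^+ 'C(j, 2).
  by rewrite -exprD subnK.
have -> : p ^+ 'C(j, 2) = expR (- ('C(j, 2)%:R * L)).
  by rewrite p_exp -expRM_natl mulrN.
have pe : 0 <= p ^+ ('C(k, 2) - 'C(j, 2)) by rewrite exprn_ge0 // ltW.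
rewrite [leLHS]mulrA -[X in X * _ <= _]natrM.
apply: (@le_trans _ _ ((k ^ j * k ^ j * 'C(n, k))%:R * p ^+ ('C(k, 2) - 'C(j, 2)))).
  by rewrite ler_wpM2r // ler_nat.
rewrite le_eqVlt; apply/orP; left; apply/eqP.
rewrite !natrM !natrX k_exp n_exp -!expRM_natl.
have -> : expR (2 * j%:R * kap - j%:R * l + 'C(j, 2)%:R * L) =
    expR (j%:R * kap) * expR (j%:R * kap) * expR (- (j%:R * l)) * expR ('C(j, 2)%:R * L).
  by rewrite -!expRD; congr expR; ring.
rewrite !expRN; field.
by rewrite !gt_eqF ?expR_gt0.
Qed.

(** Now [K] is modified by exchanging [k - j] vertices. Each exchange offers at most [k * n] choices
    and costs [p ^ (j - 1)] by [bin2_gap]. *)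
Lemma overlap_term_large j : (j <= k)%N -> kap + l <= (j%:R - 1) * L -> (0 < j)%N ->
  ('C(k, j) * 'C(n - k, k - j))%:R * p ^+ ('C(k, 2) - 'C(j, 2)) <= 1.
Proof.
move=> jk jL j0.
have nat_le : ('C(k, j) * 'C(n - k, k - j) <= k ^ (k - j) * n ^ (k - j))%N.
  rewrite -(bin_sub jk) leq_mul ?bin_le_expn //.
  apply: leq_trans (bin_le_expn _ _) _.
  by case: (k - j)%N => // m; rewrite leq_exp2r // leq_subr.
have gap : ((k - j) * j.-1 <= 'C(k, 2) - 'C(j, 2))%N.
  by rewrite leq_subRL ?bin2_gap //; exact: leq_bin2l.
apply: (@le_trans _ _ ((k%:R * n%:R * p ^+ j.-1) ^+ (k - j))).
  rewrite !exprMn -!exprM -!natrX -natrM; apply: ler_pM => //.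
  - by rewrite exprn_ge0 // ltW.
  - by rewrite ler_nat.
  by rewrite mulnC ler_wiXn2l // ltW.
apply: exprn_ile1; first by rewrite !mulr_ge0 ?exprn_ge0 // ltW.
rewrite k_exp n_exp p_exp -expRM_natl -!expRD -[leRHS]expR0 ler_expR.
have -> : j.-1%:R = j%:R - 1 :> R by rewrite -{2}(prednK j0) -natr1 addrK.
by rewrite mulrN subr_le0.
Qed.

(** Split at [(j - 1) * L = 19 / 10 * l]. Above it, [p ^ (j - 1)] is below [1 / (k * n)] and the
    term is at most 1, while [mu >= n ^ (2 + a)] exceeds [n ^ 2 * g ^ 7 = n ^ (2 + 7 * a / 40)]. *)
Lemma overlap_terms_le (gam a : R) : k%:R <= expR (l / 280) -> (3 <= k)%N ->
  0 <= l -> L <= l / 1000 -> 0 <= a <= 1 -> a <= gam - 2 ->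
  expected_kcliques p n k = expR (gam * l) ->
  forall j, (2 < j <= k)%N ->
    ('C(k, j) * 'C(n - k, k - j))%:R * p ^+ ('C(k, 2) - 'C(j, 2)) <=
    (n%:R ^+ 2 * expR (a * l / 40) ^+ 7)^-1 * expected_kcliques p n k.
Proof.
move=> kl k3 l0 Ll /andP[a0 a1] agam muE j /andP[j2 jk].
have {}kl : kap <= l / 280 by rewrite -ler_expR -k_exp.
have j3 : 3 <= j%:R :> R by rewrite ler_nat.
have E : (n%:R ^+ 2 * expR (a * l / 40) ^+ 7)^-1 = expR (- (2 * l + 7 / 40 * (a * l))).
  by rewrite n_exp -!expRM_natl -expRD -expRN; congr (expR _); field.
rewrite E; have [jL|jL] := leP ((j%:R - 1) * L) (19 / 10 * l).
  apply: le_trans (overlap_term_small jk) _.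
  rewrite ler_wpM2r ?muE ?expR_ge0 // ler_expR natr_bin2.
  by have := @small_overlap_exponent R l L kap j%:R a l0 L0 Ll kl j3 a1 jL; lra.
apply: (@le_trans _ _ 1).
  by apply: overlap_term_large => //; [lra | exact: leq_trans j2].
rewrite muE -expRD -[leLHS]expR0 ler_expR.
have : a * l <= (gam - 2) * l by rewrite ler_wpM2r.
have : 0 <= a * l by rewrite mulr_ge0.
by lra.
Qed.

End OverlapTerms.

Lemma has_edge_disjoint_kcliques_le (R : realType) (n k : nat) (m m' : R)
    (G : {set {set 'I_n}}) : m <= m' ->
  has_edge_disjoint_kcliques k m' G -> has_edge_disjoint_kcliques k m G.
Proof.
move=> mm /existsP[F /andP[FG mF]]; apply/existsP; exists F.
by rewrite FG (le_trans mm).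
Qed.

(** By the default [ln 0 = 0], a positive [gamma_of] excludes ['C(n, k) = 0]. *)
Lemma expected_kcliques_exp (R : realType) (n k : nat) (p : R) :
  0 < p -> 0 < ln n%:R :> R -> 0 < gamma_of p n k ->
  expected_kcliques p n k = expR (gamma_of p n k * ln n%:R) /\ (k <= n)%N.
Proof.
move=> p0 l0 gam0.
have bin0 : (0 < 'C(n, k))%N.
  rewrite lt0n; apply: contraTneq gam0 => b0.
  by rewrite /gamma_of /expected_kcliques b0 mul0r ln0 // mul0r ltxx.
split; last by rewrite -bin_gt0.
rewrite /gamma_of mulfVK ?gt_eqF // lnK // posrE /expected_kcliques.
by rewrite mulr_gt0 ?exprn_gt0 // ltr0n.
Qed.

(** Rests on ['C(n, k) <= n ^ k]. It yields both [3 <= k] and, for [p] bounded away from 1,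
    [k = O(log n)]. *)
Lemma gamma_of_le (R : realType) (n k : nat) (p : R) :
  0 < p <= 1 -> 0 < ln n%:R :> R -> 0 < gamma_of p n k ->
  gamma_of p n k * ln n%:R <= k%:R * ln n%:R - 'C(k, 2)%:R * ln p^-1.
Proof.
move=> /andP[p0 p1] l0 gam0; have [muE _] := expected_kcliques_exp p0 l0 gam0.
have n0 : 0 < n%:R :> R.
  by rewrite ltr0n lt0n; apply: contraTneq l0 => ->; rewrite ln0 // ltxx.
rewrite -ler_expR -muE /expected_kcliques expRD.
have -> : expR (- ('C(k, 2)%:R * ln p^-1)) = p ^+ 'C(k, 2).
  by rewrite lnV ?posrE // mulrN opprK expRM_natl lnK ?posrE.
rewrite expRM_natl lnK ?posrE // ler_wpM2r ?exprn_ge0 ?(ltW p0) //.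
by rewrite -natrX ler_nat bin_le_expn.
Qed.

(** Passing from squares to binomials only helps: [n / k <= (n - 1) / (k - 1)] when [k <= n]. *)
Lemma clique_bound_le (R : realType) (p gam s : R) (n k : nat) :
  0 < p -> (2 <= k)%N -> (k <= n)%N -> 0 <= s ->
  s = Num.min (Num.min (gam - 2) 1 * ln n%:R / (20 * k%:R ^+ 2)) 1 ->
  clique_bound p gam n k <= s * (p * 'C(n, 2)%:R) / (2 * 'C(k, 2)%:R).
Proof.
move=> p0 k2 kn s0 sE.
have k0 : 0 < k%:R :> R by rewrite ltr0n (leq_trans _ k2).
have k1 : 0 < k%:R - 1 :> R by rewrite subr_gt0 ltr1n.
have kn' : k%:R <= n%:R :> R by rewrite ler_nat.
set a := Num.min (gam - 2) 1 in sE *.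
have -> : clique_bound p gam n k = s * (p * n%:R ^+ 2 / (2 * k%:R ^+ 2)).
  rewrite /clique_bound -/a sE.
  rewrite [RHS]minr_pMl ?divr_ge0 ?mulr_ge0 ?exprn_ge0 ?(ltW p0) ?(ltW k0) //.
  by rewrite [1 * _]mul1r; congr (Num.min _ _); field; rewrite gt_eqF.
rewrite -[leRHS]mulrA ler_wpM2l // !natr_bin2.
have -> : p * n%:R ^+ 2 / (2 * k%:R ^+ 2) = p * n%:R / (2 * k%:R) * (n%:R / k%:R).
  by field; rewrite gt_eqF.
have -> : p * (n%:R * (n%:R - 1) / 2) / (2 * (k%:R * (k%:R - 1) / 2)) =
    p * n%:R / (2 * k%:R) * ((n%:R - 1) / (k%:R - 1)).
  by field; rewrite !gt_eqF.
rewrite ler_wpM2l ?divr_ge0 ?mulr_ge0 ?(ltW p0) ?(ltW k0) //.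
rewrite ler_pdivrMr // mulrAC ler_pdivlMr //.
by lra.
Qed.

Lemma clique_packing_probability (R : realType) (n k : nat) (p : R) :
  let l := ln n%:R in let gam := gamma_of p n k in
  let a := Num.min (gam - 2) 1 in let g := expR (a * l / 40) in
  0 < p < 1 -> 2 < gam -> 4 <= l -> l <= g -> 100 ^+ 2 * k%:R ^+ 7 <= g ->
  ln p^-1 <= l / 1000 -> 1 <= a * expR (l / 2) ->
  1 - 2 / g - 100 ^+ 2 / g <=
  Gnp_prob p (has_edge_disjoint_kcliques k (clique_bound p gam n k) (n := n)).
Proof.
move=> l gam a g /andP[p0 p1] gam2 l4 lg kg pl al.
have p01 : 0 < p <= 1 by rewrite p0 ltW.
have l0 : 0 < l by lra.
have gam0 : 0 < gam by lra.
have [muE kn] := expected_kcliques_exp p0 l0 gam0; rewrite -/l -/gam in muE.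
have gamk := gamma_of_le p01 l0 gam0; rewrite -/l -/gam in gamk.
have n0 : 0 < n%:R :> R.
  by rewrite ltr0n lt0n; apply: contraTneq l0 => n0; rewrite /l n0 ln0 // ltxx.
have n_exp : n%:R = expR l by rewrite lnK ?posrE.
have L0 : 0 < ln p^-1 by rewrite ln_gt0 // invf_gt1.
have a01 : 0 < a <= 1.
  by rewrite /a lt_min ge_min lexx orbT ltr01 andbT subr_gt0 gam2.
have agam : a <= gam - 2 by rewrite /a ge_min lexx.
have k3 : (3 <= k)%N.
  rewrite -(ltr_nat R) -(ltr_pM2r l0); apply: lt_le_trans (_ : gam * l <= _).
    by rewrite ltr_pM2r.
  by apply: le_trans gamk _; rewrite gerBl mulr_ge0 // ltW.
have k0 : 0 < k%:R :> R by rewrite ltr0n (leq_trans _ k3).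
have k_exp : k%:R = expR (ln k%:R) :> R by rewrite lnK ?posrE.
have p_exp : p = expR (- ln p^-1) by rewrite lnV ?posrE // opprK lnK ?posrE.
move: (a01) => /andP[a0 a1].
have al1 : a * l <= l by rewrite ler_piMl // ltW.
have gl : g <= expR (l / 40) by rewrite ler_expR; lra.
have k1 : 1 <= k%:R :> R by rewrite ler1n (leq_trans _ k3).
(* Here [280 = 7 * 40], from [k ^ 7 <= g <= n ^ (1 / 40)]. *)
have k280 : k%:R <= expR (l / 280).
  rewrite -(@ler_pXn2r _ 7) ?nnegrE ?expR_ge0 ?(ltW k0) //.
  rewrite -expRM_natl.
  have -> : 7 * (l / 280) = l / 40 by field.
  apply: le_trans gl; apply: le_trans kg; rewrite ler_peMl ?exprn_ge0 ?(ltW k0) //.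
  by rewrite expr2; lra.
have rk : 'C(k, 2)%:R <= k%:R ^+ 2 / 2 :> R.
  by rewrite natr_bin2 ler_pM2r ?invr_gt0 // expr2 ler_pM2l // gerBl.
have W1 : expR l <= p * 'C(n, 2)%:R.
  have n2 : 2 <= n%:R :> R by rewrite ler_nat (leq_trans _ kn) // ltnW.
  have pge : expR (- (l / 1000)) <= p by rewrite p_exp ler_expR lerN2.
  have e4 : 4 <= expR (l - l / 1000) by have := expR_ge1Dx (l - l / 1000); lra.
  have bge : n%:R ^+ 2 / 4 <= 'C(n, 2)%:R :> R.
    rewrite natr_bin2; have : n%:R * 2 <= n%:R * n%:R :> R by rewrite ler_pM2l.
    by rewrite expr2; lra.
  apply: (@le_trans _ _ (expR (- (l / 1000)) * (n%:R ^+ 2 / 4))); last first.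
    by apply: ler_pM; rewrite ?expR_ge0 ?divr_ge0 ?exprn_ge0 // ltW.
  have -> : expR (- (l / 1000)) * (n%:R ^+ 2 / 4) = expR l * (expR (l - l / 1000) / 4).
    by rewrite n_exp expRD; field.
  by rewrite ler_peMr ?expR_ge0 // ler_pdivlMr // mul1r.
(* The denominator makes [2 * s * r <= a * l / 20], that is [expR (2 * s * r) <= g ^ 2]. *)
pose s := Num.min (a * l / (20 * k%:R ^+ 2)) 1.
have kk : 0 < 20 * k%:R ^+ 2 :> R by rewrite mulr_gt0 ?exprn_gt0.
have s01 : 0 < s <= 1.
  by rewrite /s lt_min ge_min lexx orbT ltr01 !andbT divr_gt0 ?mulr_gt0.
have sle : s <= a * l / (20 * k%:R ^+ 2) by rewrite /s ge_min lexx.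
have sge : a / (20 * k%:R ^+ 2) <= s.
  rewrite /s le_min; apply/andP; split.
    by rewrite ler_pM2r ?invr_gt0 // ler_peMr ?(ltW a0) //; lra.
  rewrite ler_pdivrMr // mul1r (le_trans a1) //.
  have : 1 <= k%:R ^+ 2 :> R by rewrite exprn_ege1.
  by lra.
have prob : 1 - 2 / g - 100 ^+ 2 / g <= Gnp_prob p
    (has_edge_disjoint_kcliques k (s * (p * 'C(n, 2)%:R) / (2 * 'C(k, 2)%:R)) (n := n)).
  apply: packing_probability_ge => //.
  - by rewrite p0.
  - apply: le_trans kg; rewrite ler_pM2l ?exprn_gt0 //.
    have -> : k%:R ^+ 7 = k%:R * (k%:R ^+ 2) ^+ 3 :> R by rewrite -exprM -exprS.
    rewrite ler_pM2l // lerXn2r ?nnegrE ?exprn_ge0 ?(ltW k0) //.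
    by rewrite -natrX ler_nat bin_le_expn.
  - by rewrite n_exp ler_expR.
  - apply: le_trans W1; apply: le_trans gl _; rewrite ler_expR; lra.
  - apply: (@le_trans _ _ (a / (20 * k%:R ^+ 2) * expR l)); last first.
      by apply: ler_pM; rewrite ?expR_ge0 ?divr_ge0 ?(ltW a0) ?(ltW kk).
    rewrite mulrAC ler_pdivlMr //.
    apply: (@le_trans _ _ (expR (l / 2))); last first.
      rewrite (_ : l = l / 2 + l / 2) ?expRD; last by field.
      rewrite (_ : l / 2 + l / 2 = l); last by field.
      by rewrite mulrA ler_peMl ?expR_ge0.
    apply: (@le_trans _ _ (100 ^+ 2 * k%:R ^+ 7)); last first.
      apply: le_trans kg _; apply: le_trans gl _; rewrite ler_expR; lra.
    apply: (@le_trans _ _ (100 ^+ 2 * k%:R ^+ 4)); last first.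
      by rewrite ler_pM2l ?exprn_gt0 // ler_weXn2l.
    have k4 : 0 <= k%:R ^+ 4 :> R by rewrite exprn_ge0 ?(ltW k0).
    have : 'C(k, 2)%:R * k%:R ^+ 2 <= k%:R ^+ 2 / 2 * k%:R ^+ 2 :> R.
      by rewrite ler_wpM2r ?exprn_ge0 ?(ltW k0).
    have -> : k%:R ^+ 2 / 2 * k%:R ^+ 2 = k%:R ^+ 4 / 2 :> R by field.
    by rewrite [100 ^+ 2]expr2; lra.
  - rewrite /g -expRM_natl ler_expR.
    have -> : 2 * (a * l / 40) = 2 * (a * l / (20 * k%:R ^+ 2)) * (k%:R ^+ 2 / 2).
      by field; rewrite gt_eqF.
    apply: ler_pM => //; first by rewrite mulr_ge0 //; case/andP: s01 => /ltW.
    by rewrite ler_pM2l.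
  - apply: (@overlap_terms_le R n k p l (ln p^-1) (ln k%:R) n_exp k_exp p_exp _ kn gam a) => //.
    + exact: ltW.
    + exact: ltW.
    + by rewrite ltW.
apply: le_trans prob _; rewrite !Gnp_probE; apply: le_Gnp_mean => [|G _].
  by rewrite !ltW.
rewrite ler_nat; case: (boolP (has_edge_disjoint_kcliques k (_ / _) G)) => // h.
rewrite (has_edge_disjoint_kcliques_le _ h) //.
apply: clique_bound_le => //; first exact: ltnW.
by case/andP: s01 => /ltW.
Qed.

(** * Asymptotics in the number of vertices *)

Lemma near_ln_ge (R : realType) (X : R) :
  \forall n \near \oo%classic, X <= ln (n%:R : R).
Proof.
apply: filterS (nbhs_infty_ger (expR X)) => n Xn.
by rewrite -ler_expR lnK // posrE (lt_le_trans _ Xn) // expR_gt0.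
Qed.

(** The degree 8 term of the exponential series beats degree 7 by a factor [l], which absorbs the
    constants. *)
Lemma polylog_le_exp (R : realType) (c A l : R) : 0 < c -> 1 <= A -> 1 <= l ->
  100 ^+ 2 * A ^+ 7 * 8`!%:R / c ^+ 8 <= l -> 100 ^+ 2 * (A * l) ^+ 7 <= expR (c * l).
Proof.
move=> c0 A1 l1; rewrite ler_pdivrMr ?exprn_gt0 // => h.
have l0 : 0 < l by lra.
have f0 : 0 < 8`!%:R :> R by rewrite ltr0n fact_gt0.
have cl0 : 0 <= c * l by rewrite mulr_ge0 // ltW.
apply: le_trans (expR_ge1Dxn 7 cl0); apply: (@le_trans _ _ ((c * l) ^+ 8 / 8`!%:R)).
  rewrite ler_pdivlMr //.
  have -> : 100 ^+ 2 * (A * l) ^+ 7 * 8`!%:R = 100 ^+ 2 * A ^+ 7 * 8`!%:R * l ^+ 7.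
    by rewrite exprMn; ring.
  have -> : (c * l) ^+ 8 = l * c ^+ 8 * l ^+ 7 by rewrite exprMn [l ^+ 8]exprS; ring.
  by rewrite ler_pM2r ?exprn_gt0.
by rewrite lerDr.
Qed.

(** Positivity of [gamma_of] in [gamma_of_le] gives [(k - 1) * ln p^-1 <= 2 * ln n]; the summand 1
    covers the shift from [k - 1] to [k], as [ln n >= 1]. *)
Lemma clique_size_le (R : realType) (n k : nat) (p Lp : R) :
  0 < p < 1 -> 1 <= ln n%:R :> R -> 0 < gamma_of p n k -> 0 < Lp -> Lp <= ln p^-1 ->
  k%:R <= (1 + 2 / Lp) * ln n%:R.
Proof.
move=> /andP[p0 p1] l1 gam0 Lp0 LpL.
have l0 : 0 < ln n%:R :> R by lra.
have p01 : 0 < p <= 1 by rewrite p0 ltW.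
have := gamma_of_le p01 l0 gam0; set l := ln _ in l1 l0 *.
have : 0 < gamma_of p n k * l by rewrite mulr_gt0.
case: k gam0 => [|k] gam0 gl gk.
  by rewrite mulr_ge0 ?(ltW l0) // addr_ge0 // divr_ge0 // ltW.
have k0 : 0 < k.+1%:R :> R by rewrite ltr0n.
have kL : k%:R * ln p^-1 <= 2 * l.
  rewrite -(ler_pM2l k0); move: gl gk; rewrite natr_bin2 -natr1 addrK; lra.
have kLp : k%:R * Lp <= 2 * l by apply: le_trans kL; rewrite ler_wpM2l.
have : k%:R <= 2 * l / Lp by rewrite ler_pdivlMr.
by rewrite -natr1 (_ : (1 + 2 / Lp) * l = l + 2 * l / Lp); [lra | ring].
Qed.

Local Open Scope classical_set_scope.

Theorem theorem1p2 (R : realType) (gamma_minus p_plus : R)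
    (p gamma : nat -> R) (k : nat -> nat)
    (hgamma : 2 < gamma_minus) (hp : 0 < p_plus < 1)
    (hLambda : Lambda gamma_minus p_plus p gamma k) :
  (fun n : nat =>
     @Gnp_prob R n (p n)
       (has_edge_disjoint_kcliques (k n)
          (clique_bound (p n) (gamma n) n (k n)))) @ \oo --> (1 : R).
Proof.
case: hLambda => p_lt p_lim _ gammaE gamma_ge.
have /andP[pp0 pp1] := hp.
pose Lp := ln p_plus^-1.
have Lp0 : 0 < Lp by rewrite ln_gt0 // invf_gt1.
pose A := 1 + 2 / Lp.
have A1 : 1 <= A by rewrite lerDl divr_ge0 // ltW.
(* A lower bound for [a] that is uniform in [n], so that [g] is at least the fixed power
   [n ^ (c0 / 40)]. *)
pose c0 := Num.min (gamma_minus - 2) 1.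
have c00 : 0 < c0 by rewrite lt_min subr_gt0 hgamma ltr01.
have p_small : \forall n \near \oo, `|0 - ln (p n) / ln n%:R| <= 1000^-1.
  have e1 : 0 < 1000^-1 :> R by rewrite invr_gt0 ltr0n.
  by have /cvgrPdist_le/(_ _ e1) := p_lim.
apply/cvgrPdist_le => e e0; near=> n.
have l4 : 4 <= ln n%:R :> R by near: n; exact: near_ln_ge.
have lc : 2 / c0 <= ln n%:R by near: n; exact: near_ln_ge.
have lA : 100 ^+ 2 * A ^+ 7 * 8`!%:R / (c0 / 40) ^+ 8 <= ln n%:R.
  by near: n; exact: near_ln_ge.
have le : (2 + 100 ^+ 2) / e <= ln n%:R by near: n; exact: near_ln_ge.
have pl : `|0 - ln (p n) / ln n%:R| <= 1000^-1.
  by near: n.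
have gn : gamma_minus <= gamma n by near: n.
have n2 : (2 <= n)%N by near: n; exists 2%N.
have /andP[pn0 pnp] := p_lt n (ltnW n2).
have pn1 : p n < 1 by exact: lt_trans pp1.
have p01 : 0 < p n < 1 by rewrite pn0.
rewrite gammaE // in gn *.
move: l4 lc lA le pl; set l := ln n%:R; set gam := gamma_of _ _ _ in gn *.
move=> l4 lc lA le pl.
have l0 : 0 < l by lra.
have gam2 : 2 < gam by lra.
pose a := Num.min (gam - 2) 1.
have ac : c0 <= a by rewrite le_min ge_min ge_min lexx orbT andbT lerD2r gn.
have kA : (k n)%:R <= A * l.
  apply: (clique_size_le p01) => //; first by rewrite -/l; lra.
    by rewrite -/gam; lra.
  by rewrite ler_ln ?posrE ?invr_gt0 // lef_pV2 ?posrE // ltW.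
pose g := expR (a * l / 40).
have kg' : 100 ^+ 2 * (A * l) ^+ 7 <= g.
  apply: le_trans (polylog_le_exp _ A1 _ lA) _; rewrite ?divr_gt0 //; first by lra.
  rewrite ler_expR.
  have : c0 * l <= a * l by rewrite ler_pM2r.
  by lra.
have kg : 100 ^+ 2 * (k n)%:R ^+ 7 <= g.
  apply: le_trans kg'; rewrite ler_pM2l ?exprn_gt0 // lerXn2r ?nnegrE //.
  by rewrite mulr_ge0 ?(ltW l0) //; lra.
have lg : l <= g.
  apply: le_trans kg'.
  have Al : l <= A * l by rewrite ler_peMl // ltW.
  have AlX : A * l <= (A * l) ^+ 7 by rewrite -[leLHS]expr1 ler_weXn2l //; lra.
  by rewrite [100 ^+ 2]expr2; lra.
have g0 : 0 < g by exact: expR_gt0.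
have pl' : ln (p n)^-1 <= l / 1000.
  move: pl; rewrite sub0r normrN ler_norml => /andP[pl _].
  rewrite lnV ?posrE //; move: pl; rewrite ler_pdivlMr //; lra.
have al : 1 <= a * expR (l / 2).
  have : l / 2 <= expR (l / 2) by have := expR_ge1Dx (l / 2); lra.
  have : c0 * (l / 2) <= a * expR (l / 2).
    apply: ler_pM; rewrite ?(ltW c00) //; first by lra.
    by have := expR_ge1Dx (l / 2); lra.
  by move: lc; rewrite ler_pdivrMr //; lra.
have := clique_packing_probability p01 gam2 l4 lg kg pl' al.
rewrite -/gam -/l -/a -/g.
have := @Gnp_prob_le1 R n (p n) _ (has_edge_disjoint_kcliques (k n)
   (clique_bound (p n) gam n (k n)) (n := n)).
set P := Gnp_prob _ _ => P1 Pge.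
have {}P1 : P <= 1 by apply: P1; rewrite !ltW.
rewrite ger0_norm ?subr_ge0 //.
have : (2 + 100 ^+ 2) / g <= e.
  rewrite ler_pdivrMr // mulrC -ler_pdivrMr //; exact: le_trans lg.
by move: Pge; lra.
Unshelve. all: by end_near.
Qed.
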